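(* Let $\mathcal H$ be a finite-dimensional real Hilbert space, identified with $\mathbb R^n$, let $T:\mathcal H\to\mathcal H$ be $\alpha$-averaged for some $\alpha\in(0,1]$ with $\operatorname{fix}T\neq\emptyset$, and let $R=\mathrm{id}-T$. Consider the sequence $(x_k)_{k\in\mathbb N}$ generated by the SuperMann scheme (described in the context), with $(d_k)_{k\in\mathbb N}$ selected by the modified Broyden's scheme (described in the context) for some $\bar\vartheta\in(0,1)$. Suppose that the sequence of matrices $(H_k)_{k\in\mathbb N}$ remains bounded, and that $R$ is calmly semidifferentiable and metrically subregular at the limit $x_\star$ of $(x_k)_{k\in\mathbb N}$. Then $(d_k)_{k\in\mathbb N}$ satisfies the Dennis–Moré condition $$\lim_{k\to\infty}\frac{\|Rx_k+JRx_\star\,d_k\|}{\|d_k\|}=0 .$$ In particular, the directions are superlinear, i.e. $\lim_{k\to\infty}\|R(x_k+d_k)\|/\|Rx_k\|=0$, and, if either $c_0>0$ or $c_1>0$, then: (i) eventually, the stepsize $\tau_k=1$ is always accepted and safeguard updates $K_2$ are deactivated (i.e., the scheme reduces to $x_{k+1}=x_k+d_k$ for all $k$ large enough); (ii) $(Rx_k)_{k\in\mathbb N}$ converges $Q$-superlinearly (to $0$); (iii) $(x_k)_{k\in\mathbb N}$ converges $R$-superlinearly; (iv) if $c_0>0$, then $\mathbb N\setminus K_0$ is finite.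
   Context: An operator $T$ is nonexpansive if $\|Tx-Ty\|\le\|x-y\|$ for all $x,y\in\mathcal H$; it is $\alpha$-averaged, $\alpha\in(0,1)$, if $T=(1-\alpha)\mathrm{id}+\alpha S$ for some nonexpansive $S:\mathcal H\to\mathcal H$; $1$-averaged means nonexpansive. $\operatorname{fix}T=\{z: Tz=z\}=\operatorname{zer}R=\{z:Rz=0\}$. $\|\cdot\|$, $\langle\cdot,\cdot\rangle$ are those of $\mathcal H$; $\|\cdot\|_2$, $\langle\cdot,\cdot\rangle_2$ are Euclidean. $R$ is metrically subregular at $\bar x\in\operatorname{zer}R$ if there exist $\varepsilon,\gamma>0$ such that $\operatorname{dist}(x,\operatorname{zer}R)\le\gamma\|Rx\|$ for all $x$ with $\|x-\bar x\|<\varepsilon$. $R$ is semidifferentiable at $\bar x$ if there is a continuous positively homogeneous function $DR\bar x:\mathcal H\to\mathcal H$ (the semiderivative) with $Rx=R\bar x+DR\bar x[x-\bar x]+o(\|x-\bar x\|)$. $R$ is calmly semidifferentiable at $\bar x$ if there is a neighborhood $U_{\bar x}$ of $\bar x$ in which $R$ is semidifferentiable and such that for all $w\in\mathcal H$ with $\|w\|=1$ the function $U_{\bar x}\ni x\mapsto DRx[w]$ is Lipschitz continuous at $\bar x$. (Calm semidifferentiability at $\bar x$ is known to imply strict differentiability, hence differentiability, at $\bar x$; $JR\bar x$ denotes the Jacobian.) $Q$-superlinear convergence of $(Rx_k)$ to $0$: $\|Rx_{k+1}\|/\|Rx_k\|\to0$. $R$-superlinear convergence of $(x_k)$ to $x_\star$: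 $\|x_k-x_\star\|\le\Delta_k$ for some positive sequence $\Delta_k\to0$ with $\Delta_{k+1}/\Delta_k\to0$. SuperMann scheme. Parameters: $x_0\in\mathcal H$, $c_0,c_1,q\in[0,1)$, $\beta,\sigma\in(0,1)$, $\lambda\in(0,1/\alpha)$. Initialize $\eta_0=r_{\rm safe}=\|Rx_0\|$, $k=0$. Step 1. If $Rx_k=0$, stop. Step 2. Choose an update direction $d_k\in\mathcal H$. Step 3 (blind update, $k\in K_0$). If $\|Rx_k\|\le c_0\eta_k$, set $\eta_{k+1}=\|Rx_k\|$, $x_{k+1}=w_k:=x_k+d_k$ (the full step, $\tau_k=1$), and go to step 6. Step 4. Otherwise set $\eta_{k+1}=\eta_k$ and $\tau_k=1$. Step 5. Let $w_k=x_k+\tau_kd_k$. (a) (educated update, $k\in K_1$) If $\|Rx_k\|\le r_{\rm safe}$ and $\|Rw_k\|\le c_1\|Rx_k\|$, set $x_{k+1}=w_k$, update $r_{\rm safe}=\|Rw_k\|+q^k$, and go to step 6. (b) (safeguard update, $k\in K_2$) Else, if $\rho_k:=\|Rw_k\|^2-2\alpha\langle Rw_k,w_k-x_k\rangle\ge\sigma\|Rw_k\|\|Rx_k\|$, set $x_{k+1}=x_k-\lambda\frac{\rho_k}{\|Rw_k\|^2}Rw_k$ and go to step 6; otherwise replace $\tau_k\gets\beta\tau_k$ and repeat step 5. Step 6. Set $k\gets k+1$ and go to step 1. $K_0,K_1,K_2$ are the sets of indices of blind, educated and safeguard iterations. Standing assumption: no solution is found in finitely many steps, i.e. $Rx_k\ne0$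 for all $k$ and $Rw_k\neq0$ for all candidate points $w_k$. Modified Broyden's scheme with parameter $\bar\vartheta\in(0,1)$: starting from an invertible $B_0\in\mathbb R^{n\times n}$, set $d_k=-B_k^{-1}Rx_k$ and $$B_{k+1}=B_k+\frac{1}{\|s_k\|_2^2}(\tilde y_k-B_ks_k)s_k^\top,$$ where, with $w_k$ the final value of $w_k$ in iteration $k$ of the scheme, $s_k=w_k-x_k$, $y_k=Rw_k-Rx_k$, $\tilde y_k=(1-\vartheta_k)B_ks_k+\vartheta_ky_k$, $\gamma_k:=\langle B_k^{-1}y_k,s_k\rangle_2/\|s_k\|_2^2$, and $\vartheta_k=1$ if $|\gamma_k|\ge\bar\vartheta$, $\vartheta_k=\frac{1-\operatorname{sign}(\gamma_k)\bar\vartheta}{1-\gamma_k}$ if $|\gamma_k|<\bar\vartheta$, with the convention $\operatorname{sign}0=1$. All $B_k$ are invertible, and $H_k:=B_k^{-1}$. *)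

(* Defs.v *)
From HB Require Import structures.
From mathcomp Require Import all_boot all_order all_algebra.
From mathcomp Require Import sesquilinear.
From mathcomp Require Import all_classical all_reals all_analysis.
Import Order.TTheory GRing.Theory Num.Theory.
Import numFieldNormedType.Exports.

Set Implicit Arguments.
Unset Strict Implicit.
Unset Printing Implicit Defensive.

Local Open Scope classical_set_scope.
Local Open Scope ring_scope.

(* The Hilbert space H is 'cV[R]_n with an arbitrary inner product ip, not
   necessarily the Euclidean one.  Topological notions (nbhs, continuity, little-o,
   differentiability, convergence) are the library's, relative to the sup norm on
   'cV[R]_n; since all norms on 'cV[R]_n are equivalent they do not depend on
   that choice.  Norms occurring explicitly are the one induced by ip. *)

Section Operators.
Variables (R : realType) (n : nat).
Local Notation V := 'cV[R]_n.
Variable ip : {dot V for idfun}.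

Definition hnorm (x : V) : R := Num.sqrt (ip x x).

Definition dist (x : V) (A : set V) : R := inf [set hnorm (x - z) | z in A].

Definition nonexpansive (S : V -> V) : Prop :=
  forall x y, hnorm (S x - S y) <= hnorm (x - y).

(* For alpha = 1 this is literally nonexpansiveness of T. *)
Definition averaged (alpha : R) (T : V -> V) : Prop :=
  exists S : V -> V, nonexpansive S /\
    forall x, T x = (1 - alpha) *: x + alpha *: S x.

Definition fix_set (T : V -> V) : set V := [set z | T z = z].

Definition residual (T : V -> V) (x : V) : V := x - T x.

Definition zer (F : V -> V) : set V := [set z | F z = 0].

Definition metrically_subregular (F : V -> V) (xbar : V) : Prop :=
  zer F xbar /\
  exists eps gamma : R, [/\ 0 < eps, 0 < gamma &
    forall x, hnorm (x - xbar) < eps -> dist x (zer F) <= gamma * hnorm (F x)].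

Definition is_semiderivative (F : V -> V) (xbar : V) (D : V -> V) : Prop :=
  [/\ continuous D,
      forall (t : R) w, 0 < t -> D (t *: w) = t *: D w &
      forall x, F x = F xbar + D (x - xbar) +o_(x \near xbar) (x - xbar)].

(* DF is determined by F on U, as semiderivatives are unique.  Lipschitz
   continuity at the point xbar compares values with the value at xbar only, and
   the modulus may depend on the direction w. *)
Definition calmly_semidifferentiable (F : V -> V) (xbar : V) : Prop :=
  exists (U : set V) (DF : V -> V -> V),
    [/\ nbhs xbar U,
        forall x, U x -> is_semiderivative F x (DF x) &
        forall w, hnorm w = 1 ->
          exists L : R, \forall x \near xbar,
            U x -> hnorm (DF x w - DF xbar w) <= L * hnorm (x - xbar)].

(* Column-vector counterpart of 'J, which the library defines for row vectors;
   meaningful when F is differentiable at x. *)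
Definition jacobian_mx (F : V -> V) (x : V) : 'M[R]_n :=
  \matrix_(i, j) ('d F x (delta_mx j 0 : V)) i 0.

End Operators.

Record supermann_params (R : realType) := SuperMannParams {
  c0 : R; c1 : R; q : R; beta : R; sigma : R; lambda : R }.

Definition valid_params (R : realType) (alpha : R) (p : supermann_params R) :
    Prop :=
  [/\ 0 <= c0 p < 1, 0 <= c1 p < 1, 0 <= q p < 1 &
  [/\ 0 < beta p < 1, 0 < sigma p < 1 & 0 < lambda p < alpha^-1]].

(* The data of an infinite run.  eta k and rsafe k are the values of these
   registers at the beginning of iteration k; backtracks k is the number of
   reductions of the stepsize made in iteration k. *)
Record supermann_run (R : realType) (n : nat) := SuperMannRun {
  iter_x : nat -> 'cV[R]_n;
  dir : nat -> 'cV[R]_n;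
  backtracks : nat -> nat;
  eta : nat -> R;
  rsafe : nat -> R }.

Section SuperMann.
Variables (R : realType) (n : nat).
Local Notation V := 'cV[R]_n.
Variables (ip : {dot V for idfun}) (T : V -> V) (alpha : R).
Variables (p : supermann_params R) (s : supermann_run R n).

Local Notation Res := (residual T).
Local Notation nrm := (hnorm ip).
Local Notation x_ := (iter_x s).

Definition candidate (k j : nat) : V := x_ k + beta p ^+ j *: dir s k.

Definition tau (k : nat) : R := beta p ^+ backtracks s k.

Definition w_ (k : nat) : V := candidate k (backtracks s k).

Definition rho (k j : nat) : R :=
  nrm (Res (candidate k j)) ^+ 2
  - 2 * alpha * ip (Res (candidate k j)) (candidate k j - x_ k).

Definition blind_test (k : nat) : bool := nrm (Res (x_ k)) <= c0 p * eta s k.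

Definition educated_test (k j : nat) : bool :=
  (nrm (Res (x_ k)) <= rsafe s k) &&
  (nrm (Res (candidate k j)) <= c1 p * nrm (Res (x_ k))).

Definition safeguard_test (k j : nat) : bool :=
  sigma p * nrm (Res (candidate k j)) * nrm (Res (x_ k)) <= rho k j.

Definition K0 : set nat := [set k | blind_test k].

Definition K1 : set nat :=
  [set k | ~~ blind_test k && educated_test k (backtracks s k)].

Definition K2 : set nat :=
  [set k | [&& ~~ blind_test k, ~~ educated_test k (backtracks s k)
             & safeguard_test k (backtracks s k)]].

Definition blind_step (k : nat) : Prop :=
  [/\ backtracks s k = 0%N, eta s k.+1 = nrm (Res (x_ k)),
      rsafe s k.+1 = rsafe s k & x_ k.+1 = w_ k].

Definition educated_step (k : nat) : Prop :=
  [/\ eta s k.+1 = eta s k, rsafe s k.+1 = nrm (Res (w_ k)) + q p ^+ k &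
      x_ k.+1 = w_ k].

Definition safeguard_step (k : nat) : Prop :=
  [/\ eta s k.+1 = eta s k, rsafe s k.+1 = rsafe s k &
      x_ k.+1 = x_ k -
        (lambda p * (rho k (backtracks s k) / nrm (Res (w_ k)) ^+ 2)) *:
          Res (w_ k)].

Definition rejected (k j : nat) : Prop :=
  ~~ educated_test k j /\ ~~ safeguard_test k j.

(* Every iteration belongs to exactly one of K0, K1, K2; outside K0 the stepsize
   is the first one in 1, beta, beta ^+ 2, ... that is not rejected. *)
Definition supermann_scheme : Prop :=
  [/\ eta s 0 = nrm (Res (x_ 0)), rsafe s 0 = nrm (Res (x_ 0)) &
      forall k,
        [\/ K0 k /\ blind_step k,
            [/\ K1 k, forall j, (j < backtracks s k)%N -> rejected k j &
                educated_step k] |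
            [/\ K2 k, forall j, (j < backtracks s k)%N -> rejected k j &
                safeguard_step k]]].

Definition never_solved : Prop :=
  (forall k, Res (x_ k) <> 0) /\
  (forall k j, (j <= backtracks s k)%N -> Res (candidate k j) <> 0).

End SuperMann.

Section Broyden.
Variables (R : realType) (n : nat).
Local Notation V := 'cV[R]_n.

Definition dot2 (u v : V) : R := (u^T *m v) 0 0.

Variables (T : V -> V) (p : supermann_params R) (s : supermann_run R n).
Variables (thetabar : R) (B : nat -> 'M[R]_n).

Definition s_ (k : nat) : V := w_ p s k - iter_x s k.

Definition y_ (k : nat) : V := residual T (w_ p s k) - residual T (iter_x s k).

Definition gamma_ (k : nat) : R :=
  dot2 (invmx (B k) *m y_ k) (s_ k) / dot2 (s_ k) (s_ k).

(* (-1) ^+ (x < 0) is the sign of x with the convention sign 0 = 1. *)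
Definition vartheta (k : nat) : R :=
  if thetabar <= `|gamma_ k| then 1
  else (1 - (-1) ^+ (gamma_ k < 0)%R * thetabar) / (1 - gamma_ k).

Definition ytilde (k : nat) : V :=
  (1 - vartheta k) *: (B k *m s_ k) + vartheta k *: y_ k.

Definition modified_broyden : Prop :=
  [/\ B 0 \in unitmx,
      forall k, dir s k = - (invmx (B k) *m residual T (iter_x s k)) &
      forall k, B k.+1 = B k +
        (dot2 (s_ k) (s_ k))^-1 *: ((ytilde k - B k *m s_ k) *m (s_ k)^T)].

End Broyden.

Definition R_superlinear (R : realType) (n : nat) (ip : {dot 'cV[R]_n for idfun})
    (x : nat -> 'cV[R]_n) (xstar : 'cV[R]_n) : Prop :=
  exists Delta : nat -> R,
    [/\ forall k, 0 < Delta k,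
        Delta @ \oo --> (0 : R),
        (fun k => Delta k.+1 / Delta k) @ \oo --> (0 : R) &
        forall k, hnorm ip (x k - xstar) <= Delta k].

Definition Q_superlinear (R : realType) (n : nat) (ip : {dot 'cV[R]_n for idfun})
    (r : nat -> 'cV[R]_n) : Prop :=
  (fun k => hnorm ip (r k.+1) / hnorm ip (r k)) @ \oo --> (0 : R).

(* Main.v *)
Require Import Defs.
From mathcomp Require Import all_boot all_order all_algebra.
From mathcomp Require Import sesquilinear.
From mathcomp Require Import all_classical all_reals all_analysis.
From mathcomp Require Import ring lra.
Import Order.TTheory GRing.Theory Num.Theory.
Import numFieldNormedType.Exports.

Local Open Scope classical_set_scope.
Local Open Scope ring_scope.

(** Write F for the residual, x_k for the iterates, r_k = |F x_k| and e_k for the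
    distance of x_k to the zeros of F, xs for the limit and J for the Jacobian
    of F at xs.

    Calmness bounds the linearization error of F near xs: it is at most
    C rho |x - y| between two points x and y at distance at most rho of xs
    ([calm_strict_estimate]).  Indeed, moving from y to x one coordinate at a
    time, the increment of F along each coordinate segment is controlled by a
    mean value inequality for right derivatives.  This involves the
    semiderivatives in the n directions of the canonical basis, and the Lipschitz
    constants and neighbourhoods that calmness attaches to these directions have
    common bounds.  The matrix of these n semiderivatives at xs is J, and F is
    differentiable at xs with Jacobian J.

    The iterates converge R-linearly.  Subregularity makes e_k and r_k
    comparable, and a safeguard step contracts e_k because it is a relaxed
    projection onto a half space containing all zeros of F.  Blind and educated
    steps may expand e_k by a constant factor, but each of them contracts a
    register, eta or rsafe, that bounds the new e_k.  The two registers do not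
    contract together, and none of e, eta and rsafe need decrease by a constant
    factor at every iteration.  But with p so large that p contractions of a
    register outweigh one expansion of e, the product e eta^p rsafe^p does, while
    e rsafe^p / eta and e eta^p / rsafe stay bounded; together with
    e = O(max(eta, rsafe)) this forces e^((p+1)^2) to decay geometrically
    ([interlocked_linear_rate]).  The steps x_(k+1) - x_k being bounded by
    multiples of e_k, also |x_k - xs| decays geometrically.

    Let B_k be the Broyden matrices and s_k = w_k - x_k.  In the Frobenius norm
    the squared error |B_k - J|^2 decreases by a multiple of
    |(B_k - J) s_k|^2 / |s_k|^2 at each update, up to a term of order
    |y_k - J s_k|^2 / |s_k|^2, which is summable by the previous two facts
    ([broyden_error_decrease]).  Hence (B_k - J) s_k = o(|s_k|).  As d_k is
    parallel to s_k and B_k d_k = - F x_k, this is the Dennis-More condition, and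
    with |d_k| = O(r_k) it makes |F (x_k + d_k)| = o(r_k).

    From some point on, full steps pass the blind test if c0 > 0, and otherwise
    the educated one: the test is passed at a late iteration because r_k tends to
    0 while its register would otherwise stay constant, and then again at every
    later one ([eventually_blind], [eventually_educated]).  The superlinear rates follow. *)

(** * Matrix norms and inner products *)

Section MatrixNorm.
Context {R : realType}.

Lemma entry_le_norm m n (A : 'M[R]_(m, n)) i j : `|A i j| <= `|A|.
Proof.
rewrite [leRHS]mx_normrE.
exact: (le_bigmax _ (fun i : 'I_m * 'I_n => `|A i.1 i.2|) (i, j)).
Qed.

Lemma norm_le_entries m n (A : 'M[R]_(m, n)) (a : R) :
  0 <= a -> (forall i j, `|A i j| <= a) -> `|A| <= a.
Proof. by move=> a0 H; rewrite [leLHS]mx_normrE; apply: bigmax_le. Qed.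

Lemma norm_mulmx_le m n p (A : 'M[R]_(m, n)) (B : 'M[R]_(n, p)) :
  `|A *m B| <= n%:R * `|A| * `|B|.
Proof.
apply: norm_le_entries => [|i j]; first by rewrite !mulr_ge0.
rewrite mxE; apply: le_trans (ler_norm_sum _ _ _) _.
apply: (@le_trans _ _ (\sum_(k < n) `|A| * `|B|)).
  by apply: ler_sum => k _; rewrite normrM ler_pM// entry_le_norm.
by rewrite sumr_const card_ord -[leLHS]mulr_natl mulrA.
Qed.

Lemma col_sum_delta n (x : 'cV[R]_n) : x = \sum_i x i 0 *: delta_mx i 0.
Proof.
rewrite {1}(matrix_sum_delta x); apply: eq_bigr => i _.
by rewrite big_ord1.
Qed.

End MatrixNorm.

Section InnerNorm.
Context {R : realType} {n : nat} (ip : {dot 'cV[R]_n for idfun}).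
Local Notation V := 'cV[R]_n.
Local Notation nrm := (hnorm ip).
Implicit Types (u v x y z : V) (a : R).

Lemma ip_sym u v : ip u v = ip v u.
Proof. by rewrite [LHS]hermC expr0 mul1r. Qed.

Lemma ipZl a u v : ip (a *: u) v = a * ip u v.
Proof. exact: linearZl_LR. Qed.

Lemma ipZr a u v : ip u (a *: v) = a * ip u v.
Proof. by rewrite ip_sym ipZl ip_sym. Qed.

Lemma ipDl u v w : ip (u + v) w = ip u w + ip v w.
Proof. exact: linearDl. Qed.

Lemma ipDr u v w : ip w (u + v) = ip w u + ip w v.
Proof. by rewrite ip_sym ipDl !(ip_sym w). Qed.

Lemma ipNl u v : ip (- u) v = - ip u v.
Proof. exact: linearNl. Qed.

Lemma ipNr u v : ip u (- v) = - ip u v.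
Proof. by rewrite ip_sym ipNl ip_sym. Qed.

Lemma ip0 : ip 0 0 = 0.
Proof. by rewrite -(scale0r 0) ipZl mul0r. Qed.

Lemma ip_gt0 u : (0 < ip u u) = (u != 0).
Proof.
by have [->|u0] := eqVneq u 0; [rewrite ip0 ltxx | exact: neq0_dnorm_gt0].
Qed.

Lemma ip_ge0 u : 0 <= ip u u.
Proof.
by have [->|u0] := eqVneq u 0; [rewrite ip0 | rewrite ltW// ip_gt0].
Qed.

Lemma ip_eq0 u : (ip u u == 0) = (u == 0).
Proof. by apply: negb_inj; rewrite -ip_gt0 lt_def ip_ge0 andbT. Qed.

Lemma ip_suml (I : Type) (r : seq I) (f : I -> V) v :
  ip (\sum_(i <- r) f i) v = \sum_(i <- r) ip (f i) v.
Proof.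
elim/big_rec2: _ => [|i x y _ <-]; last by rewrite ipDl.
by rewrite -(scale0r 0) ipZl mul0r.
Qed.

Lemma ip_sumr (I : Type) (r : seq I) (f : I -> V) v :
  ip v (\sum_(i <- r) f i) = \sum_(i <- r) ip v (f i).
Proof. by rewrite ip_sym ip_suml; apply: eq_bigr => i _; rewrite ip_sym. Qed.

Definition ipE := (ipDl, ipDr, ipNl, ipNr, ipZl, ipZr).

Lemma hnorm_ge0 u : 0 <= nrm u. Proof. exact: sqrtr_ge0. Qed.

Lemma sqr_hnorm u : nrm u ^+ 2 = ip u u.
Proof. by rewrite sqr_sqrtr ?ip_ge0. Qed.

Lemma hnorm_eq0 u : (nrm u == 0) = (u == 0).
Proof. by rewrite -(sqrf_eq0 (nrm u)) sqr_hnorm ip_eq0. Qed.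

Lemma hnorm_gt0 u : (0 < nrm u) = (u != 0).
Proof. by rewrite lt_def hnorm_eq0 hnorm_ge0 andbT. Qed.

Lemma hnorm0 : nrm 0 = 0.
Proof. by apply/eqP; rewrite hnorm_eq0. Qed.

Lemma hnormZ a u : nrm (a *: u) = `|a| * nrm u.
Proof. by rewrite /hnorm ipZl ipZr mulrA -expr2 sqrtrM ?sqr_ge0// sqrtr_sqr. Qed.

Lemma hnorm_opp u : nrm (- u) = nrm u.
Proof. by rewrite -scaleN1r hnormZ normrN1 mul1r. Qed.

Lemma hnorm_distC u v : nrm (u - v) = nrm (v - u).
Proof. by rewrite -opprB hnorm_opp. Qed.

Lemma ip_le_hnorm u v : ip u v <= nrm u * nrm v.
Proof.
have [->|v0] := eqVneq v 0; first by rewrite hnorm0 mulr0 -(scale0r u) ipZr mul0r.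
have nv : 0 < nrm v by rewrite hnorm_gt0.
have := ip_ge0 (nrm v *: u - nrm u *: v).
rewrite !ipE -!sqr_hnorm (ip_sym v u) => H.
have {}H : ip u v * (nrm u * nrm v) <= (nrm u * nrm v) ^+ 2 by nra.
have [u0|u0] := eqVneq u 0; first by rewrite u0 -(scale0r v) ipZl hnormZ normr0 !mul0r.
have nu : 0 < nrm u by rewrite hnorm_gt0.
by move: H; rewrite expr2 ler_pM2r// mulr_gt0.
Qed.

Lemma ler_hnormD u v : nrm (u + v) <= nrm u + nrm v.
Proof.
rewrite -ler_sqr ?nnegrE ?addr_ge0 ?hnorm_ge0//.
rewrite sqrrD !sqr_hnorm !ipE (ip_sym v u).
have := ip_le_hnorm u v; lra.
Qed.

Lemma ler_hnormB u v : nrm (u - v) <= nrm u + nrm v.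
Proof. by rewrite -(hnorm_opp v); exact: ler_hnormD. Qed.

Lemma ler_hdistD x y z : nrm (x - z) <= nrm (x - y) + nrm (y - z).
Proof. by have := ler_hnormD (x - y) (y - z); rewrite addrA subrK. Qed.

Lemma ler_hnorm_sum (I : Type) (r : seq I) (P : pred I) (f : I -> V) :
  nrm (\sum_(i <- r | P i) f i) <= \sum_(i <- r | P i) nrm (f i).
Proof.
elim/big_rec2: _ => [|i x y _ H]; first by rewrite hnorm0.
by apply: le_trans (ler_hnormD _ _) _; rewrite lerD2l.
Qed.

Lemma hnorm_le_norm : exists2 b, 0 < b & forall x, nrm x <= b * `|x|.
Proof.
exists (1 + \sum_i nrm (delta_mx i 0)) => [|x].
  by rewrite ltr_wpDr// sumr_ge0// => i _; exact: hnorm_ge0.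
rewrite {1}(col_sum_delta _ x); apply: le_trans (ler_hnorm_sum _ _ _ _) _.
rewrite mulrDl mul1r mulr_suml; apply: ler_wpDl => //.
apply: ler_sum => i _; rewrite hnormZ mulrC ler_wpM2l ?hnorm_ge0//.
exact: entry_le_norm.
Qed.

(** Riesz representation of a coordinate function: the Gram matrix of the canonical
    basis is invertible because the form is definite.  With Cauchy-Schwarz this
    bounds the sup norm by the inner product norm. *)
Lemma coord_riesz (i : 'I_n) : exists u, forall x, x i 0 = ip u x.
Proof.
pose G : 'M[R]_n := \matrix_(i, j) ip (delta_mx i 0) (delta_mx j 0).
have GE x u : ip x u = (x^T *m G *m u) 0 0.
  rewrite {1}(col_sum_delta _ x) {1}(col_sum_delta _ u) ip_suml mxE.
  under eq_bigr do rewrite ip_sumr.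
  rewrite exchange_big /=; apply: eq_bigr => k _.
  rewrite mxE mulr_suml; apply: eq_bigr => l _.
  by rewrite !ipE !mxE; ring.
have Gu : G \in unitmx.
  rewrite -row_free_unit -kermx_eq0; apply/eqP/row_matrixP => k.
  rewrite row0; apply/eqP; rewrite -(inj_eq trmx_inj) trmx0 -[_ == 0]negbK -ip_gt0 GE trmxK.
  have /sub_kermxP -> : (row k (kermx G) <= kermx G)%MS by exact: row_sub.
  by rewrite mul0mx mxE ltxx.
exists (((delta_mx i 0)^T *m invmx G)^T) => x.
rewrite GE trmxK mulmxKV// trmx_delta -rowE.
by rewrite mxE.
Qed.

Lemma norm_le_hnorm : exists2 b, 0 < b & forall x, `|x| <= b * nrm x.
Proof.
have /choice[u uE] := coord_riesz.
exists (1 + \sum_i nrm (u i)) => [|x].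
  by rewrite ltr_wpDr// sumr_ge0// => i _; exact: hnorm_ge0.
have s0 (P : pred 'I_n) : 0 <= \sum_(i | P i) nrm (u i).
  by rewrite sumr_ge0// => i _; exact: hnorm_ge0.
apply: norm_le_entries => [|i j].
  by rewrite mulr_ge0 ?hnorm_ge0// addr_ge0.
rewrite (ord1 j) uE; apply: (@le_trans _ _ (nrm (u i) * nrm x)).
  by rewrite ler_norml ip_le_hnorm lerNl -ipNl -(hnorm_opp (u i)) ip_le_hnorm.
rewrite ler_wpM2r ?hnorm_ge0// (bigD1 i)//= addrCA lerDl addr_ge0//.
Qed.

End InnerNorm.

(** * Strict linearization from calm semidifferentiability *)

(** The bound (M + e) t propagates along the interval: the supremum of the points
    up to which it holds satisfies it by continuity, and equals a by the local
    bound to its right. *)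
Lemma right_mean_value (R : realType) (W : normedModType R) (g : R -> W)
    (a M L : R) : 0 <= a ->
  (forall s t, `|g s - g t| <= L * `|s - t|) ->
  (forall t e : R, 0 <= t < a -> 0 < e -> exists2 d : R, 0 < d &
     forall s : R, t < s < t + d -> `|g s - g t| <= (M + e) * (s - t)) ->
  `|g a - g 0| <= M * a.
Proof.
move=> a0 gL gM.
have L0 : 0 <= L by have := gL 1 0; rewrite subr0 normr1 mulr1; apply: le_trans.
have [->|aN0] := eqVneq a 0; first by rewrite mulr0 subrr normr0.
have {aN0}ap : 0 < a by rewrite lt_def aN0.
suff H (e : R) : 0 < e -> `|g a - g 0| <= (M + e) * a.
  apply/ler_addgt0Pr => e e0; have /H : 0 < e / a by rewrite divr_gt0.
  by rewrite mulrDl divfK// gt_eqF.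
move=> e0; pose P s := `|g s - g 0| <= (M + e) * s.
pose E := [set t | 0 <= t <= a /\ forall s, 0 <= s <= t -> P s].
have E0 : E 0.
  split=> [|s]; first by rewrite lexx.
  by move=> /le_anti <-; rewrite /P subrr normr0 mulr0.
have Eub : ubound E a by move=> t [/andP[]].
have hE : has_sup E by split; [exists 0 | exists a].
pose c := sup E.
have c0 : 0 <= c by apply: ub_le_sup => //; exists a.
have ca : c <= a by apply: ge_sup => //; exists 0.
have Plt s : 0 <= s < c -> P s.
  move=> /andP[s0 sc]; have cs0 : 0 < c - s by rewrite subr_gt0.
  have [t [_ tP]] := sup_adherent cs0 hE.
  by rewrite opprB addrC subrK => st; apply: tP; rewrite s0 ltW.
(* closing the bound at the supremum: compare with c - h, using that g is Lipschitz *)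
have Pc : P c.
  have [cE|cN] := eqVneq c 0; first by rewrite /P cE subrr normr0 mulr0.
  have cp : 0 < c by rewrite lt_def cN.
  apply/ler_addgt0Pr => r r0.
  pose B := L + `|M + e| + 1.
  have B0 : 0 < B by rewrite ltr_wpDl// addr_ge0.
  pose h := Num.min c (r / B).
  have h0 : 0 < h by rewrite lt_min cp divr_gt0.
  have hc : h <= c by rewrite ge_min lexx.
  have hr : B * h <= r by rewrite mulrC -ler_pdivlMr// ge_min lexx orbT.
  have Ps : P (c - h) by apply: Plt; lra.
  have := ler_norm (M + e); have := ler_norm (- (M + e)); rewrite normrN.
  have := gL c (c - h); rewrite subKr (gtr0_norm h0).
  have := ler_distD (g (c - h)) (g c) (g 0).
  move: Ps; rewrite /P /B in hr *; nra.
have Ec : E c.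
  split=> [|s /andP[s0 sc]]; first by rewrite c0.
  have [->//|scN] := eqVneq s c.
  by apply: Plt; rewrite s0 lt_neqAle scN.
have [<-//|caN] := eqVneq c a.
have {caN}ca' : c < a by rewrite lt_neqAle caN.
have [d d0 gd] : exists2 d, 0 < d &
     forall s, c < s < c + d -> `|g s - g c| <= (M + e) * (s - c).
  by apply: gM; rewrite ?c0.
pose h := Num.min (a - c) (d / 2).
have h0 : 0 < h by rewrite lt_min subr_gt0 ca' divr_gt0.
have ha : h <= a - c by rewrite ge_min lexx.
have hd : h <= d / 2 by rewrite ge_min lexx orbT.
have : E (c + h).
  split=> [|s /andP[s0 sh]]; first by lra.
  have [sc|cs] := leP s c; first by case: Ec => _; apply; rewrite s0.
  have /gd : c < s < c + d by lra.
  have := ler_distD (g c) (g s) (g 0); move: Pc; rewrite /P; lra.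
have hub : has_ubound E by exists a.
move/(ub_le_sup hub); rewrite -/c; lra.
Qed.

Section StrictEstimate.
Context {R : realType} {n : nat}.
Local Notation V := 'cV[R]_n.
Implicit Types (F D : V -> V) (x y z e v : V).

Lemma semiderivativeP F x D : is_semiderivative F x D ->
  forall r : R, 0 < r -> exists2 d : R, 0 < d &
    forall y, `|y - x| < d -> `|F y - F x - D (y - x)| <= r * `|y - x|.
Proof.
move=> [_ _ /funext /eqaddoP FD] r /FD /nbhs_ballP[d /= d0 dF].
exists d => // y yd; have := dF y; rewrite -ball_normE /= distrC => /(_ yd).
by rewrite opprD addrA.
Qed.

(** The map sending t to F (z + t e) - t v has right derivative D t e - v at t. *)
Lemma segment_increment_bound F z e v (K M a : R) (D : R -> V -> V) :
  (forall x y, `|F x - F y| <= K * `|x - y|) -> 0 <= a ->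
  (forall t : R, 0 <= t < a -> is_semiderivative F (z + t *: e) (D t)) ->
  (forall t : R, 0 <= t < a -> `|D t e - v| <= M) ->
  `|F (z + a *: e) - F z - a *: v| <= M * a.
Proof.
move=> FK a0 FD DM; pose g (t : R) := F (z + t *: e) - t *: v.
have gB s t : g s - g t = F (z + s *: e) - F (z + t *: e) - (s - t) *: v.
  by rewrite /g scalerBl !opprB addrACA [RHS]addrACA [- _ - _]addrC.
have : `|g a - g 0| <= M * a; last first.
  by rewrite gB subr0 scale0r addr0.
apply: (@right_mean_value _ _ g a M (`|K| * `|e| + `|v|)) => //.
- move=> s t; rewrite gB mulrDl; apply: le_trans (ler_normB _ _) _; apply: lerD.
    apply: le_trans (FK _ _) _.
    rewrite opprD addrACA subrr add0r -scalerBl normrZ mulrA mulrAC.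
    by rewrite ler_wpM2r// ler_wpM2r// ler_norm.
  by rewrite normrZ mulrC.
move=> t r tI r0; have r'0 : 0 < r / (`|e| + 1) by rewrite divr_gt0// ltr_wpDl.
have e1 : 0 < `|e| + 1 by rewrite ltr_wpDl.
have [d d0 dF] := semiderivativeP _ _ _ (FD t tI) _ r'0.
exists (d / (`|e| + 1)) => [|s /andP[ts sd]]; first exact: divr_gt0.
have st : 0 < s - t by rewrite subr_gt0.
have zE : z + s *: e - (z + t *: e) = (s - t) *: e.
  by rewrite opprD addrACA subrr add0r -scalerBl.
have sdE : (s - t) * (`|e| + 1) < d by rewrite -ltr_pdivlMr// ltrBlDl.
have /dF : `|z + s *: e - (z + t *: e)| < d.
  rewrite zE normrZ gtr0_norm//; apply: le_lt_trans sdE.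
  by rewrite ler_wpM2l ?(ltW st)// lerDl.
rewrite zE normrZ (gtr0_norm st).
have [_ /(_ _ e st) -> _] := FD t tI.
move=> H; rewrite gB; set X := F _ - F _ in H *.
have -> : X - (s - t) *: v = (s - t) *: (D t e - v) + (X - (s - t) *: D t e).
  by rewrite scalerBr [RHS]addrC addrA subrK.
apply: le_trans (ler_normD _ _) _; rewrite mulrDl; apply: lerD.
  by rewrite normrZ gtr0_norm// mulrC ler_wpM2r ?(ltW st)// DM.
apply: le_trans H _; rewrite mulrCA mulrC ler_wpM2r ?(ltW st)//.
by rewrite mulrAC ler_pdivrMr// ler_wpM2l ?(ltW r0)// lerDl.
Qed.

Lemma convex_ball (c p q : V) (t rho : R) : 0 <= t <= 1 ->
  `|p - c| <= rho -> `|q - c| <= rho -> `|p + t *: (q - p) - c| <= rho.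
Proof.
move=> /andP[t0 t1] pc qc.
have -> : p + t *: (q - p) - c = (1 - t) *: (p - c) + t *: (q - c).
  by apply/matrixP => i j; rewrite !mxE; ring.
apply: le_trans (ler_normD _ _) _; rewrite !normrZ ger0_norm ?subr_ge0//.
rewrite (ger0_norm t0).
have -> : rho = (1 - t) * rho + t * rho by ring.
by apply: lerD; apply: ler_wpM2l; rewrite ?subr_ge0.
Qed.

(** The Lipschitz constants and neighbourhoods of calmness depend on the
    direction; restricted to the canonical basis they have common bounds. *)
Lemma calm_coord_directions (ip : {dot V for idfun}) F (xs : V) :
  calmly_semidifferentiable ip F xs ->
  exists (DF : V -> V -> V) (L d : R), [/\ 0 <= L, 0 < d &
    forall x, `|x - xs| < d -> is_semiderivative F x (DF x) /\
      forall i, `|DF x (delta_mx i 0) - DF xs (delta_mx i 0)| <= L * `|x - xs|].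
Proof.
move=> [U [DF [Uxs FD calm]]].
have [b b0 bN] := hnorm_le_norm ip; have [a a0 aN] := norm_le_hnorm ip.
have e0 (i : 'I_n) : 0 < hnorm ip (delta_mx i 0).
  rewrite hnorm_gt0; apply/eqP => /matrixP /(_ i 0); rewrite !mxE !eqxx.
  by move/eqP; rewrite oner_eq0.
pose w i := (hnorm ip (delta_mx i 0))^-1 *: (delta_mx i 0 : V).
(* calmness speaks of unit vectors; positive homogeneity carries it to the basis *)
have w1 i : hnorm ip (w i) = 1.
  by rewrite hnormZ gtr0_norm ?invr_gt0// mulVf// gt_eqF.
have /choice[L LP] := fun i => calm (w i) (w1 i).
have Uxsxs : U xs by exact: nbhs_singleton.
have /nbhs_ballP[d /= d0 dP] : \forall x \near xs, U x /\ forall i,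
    U x -> hnorm ip (DF x (w i) - DF xs (w i)) <= L i * hnorm ip (x - xs).
  exact: filterI Uxs (@filter_forall _ _ (fun i x => U x -> _ <= L i * _) _ _ LP).
pose M i := a * (hnorm ip (delta_mx i 0) * (`|L i| * b)).
have M0 i : 0 <= M i.
  by rewrite /M; do !apply: mulr_ge0 => //; rewrite ltW.
exists DF, (\sum_i M i), d; split=> //; first exact: sumr_ge0.
move=> x xd; have [|Ux xL] := dP x; first by rewrite -ball_normE /= distrC.
split=> [|i]; first exact: FD.
have hom y : U y ->
    DF y (delta_mx i 0) = hnorm ip (delta_mx i 0) *: DF y (w i).
  move=> /FD[_ <- // _].
  by rewrite scalerA divff ?scale1r// gt_eqF.
rewrite !hom// -scalerBr; apply: (@le_trans _ _ (M i * `|x - xs|)); last first.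
  by rewrite ler_wpM2r// (bigD1 i)//= lerDl sumr_ge0.
apply: le_trans (aN _) _; rewrite hnormZ (gtr0_norm (e0 i)) /M -!mulrA.
rewrite ler_wpM2l ?(ltW a0)// ler_wpM2l ?(ltW (e0 i))//.
apply: le_trans (xL i Ux) _; apply: le_trans (_ : `|L i| * hnorm ip (x - xs) <= _).
  by rewrite ler_wpM2r ?hnorm_ge0// ler_norm.
by rewrite ler_wpM2l.
Qed.

(** The path from y to x changes one coordinate at a time.  In the sup norm all
    its points stay as close to xs as x and y are.  A coordinate that decreases is
    traversed backwards, so that only the directions delta_mx i 0 occur. *)
Lemma calm_strict_estimate (ip : {dot V for idfun}) F (xs : V) (K : R) :
  (forall x y, `|F x - F y| <= K * `|x - y|) ->
  calmly_semidifferentiable ip F xs ->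
  exists (A : 'M[R]_n) (C d : R), [/\ 0 <= C, 0 < d &
    forall (rho : R) x y, rho < d -> `|x - xs| <= rho -> `|y - xs| <= rho ->
      `|F x - F y - A *m (x - y)| <= C * rho * `|x - y|].
Proof.
move=> FK /calm_coord_directions[DF [L [d [L0 d0 FD]]]].
pose A : 'M[R]_n := \matrix_(i, j) DF xs (delta_mx j 0) i 0.
have AE j : A *m delta_mx j 0 = DF xs (delta_mx j 0).
  by rewrite -colE; apply/matrixP => i k; rewrite !mxE (ord1 k).
exists A, (n%:R * L), d; split=> // [|rho x y rhod xr yr].
  by rewrite mulr_ge0.
have rho0 : 0 <= rho by apply: le_trans xr.
have along p (a : R) i : 0 <= a -> `|p - xs| <= rho ->
    `|p + a *: delta_mx i 0 - xs| <= rho ->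
    `|F (p + a *: delta_mx i 0) - F p - a *: (A *m delta_mx i 0)|
      <= L * rho * a.
  move=> a0 pr qr.
  have seg t : 0 <= t < a -> `|p + t *: delta_mx i 0 - xs| <= rho.
    move=> /andP[t0 ta]; have ap : 0 < a by apply: le_lt_trans ta.
    have := @convex_ball xs p (p + a *: delta_mx i 0) (t / a) rho.
    rewrite [p + _ - p]addrC addKr scalerA divfK ?gt_eqF//; apply=> //.
    by rewrite divr_ge0//= ler_pdivrMr// mul1r ltW.
  apply: (@segment_increment_bound F p _ _ K _ a
      (fun t => DF (p + t *: delta_mx i 0))) => // t /seg tr.
    by have [] := FD _ (le_lt_trans tr rhod).
  have [_ /(_ i)] := FD _ (le_lt_trans tr rhod); rewrite AE => /le_trans; apply.
  by rewrite ler_wpM2l.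
(* z j agrees with x on the first j coordinates and with y on the others *)
pose z j : V := \col_i (if (i < j)%N then x i 0 else y i 0).
have zr j : `|z j - xs| <= rho.
  apply: norm_le_entries => // i k; rewrite (ord1 k) !mxE.
  have := le_trans (entry_le_norm _ _ (x - xs) i 0) xr.
  have := le_trans (entry_le_norm _ _ (y - xs) i 0) yr.
  by rewrite !mxE; case: ifP.
have zS (j : 'I_n) : z j.+1 = z j + (x j 0 - y j 0) *: delta_mx j 0.
  apply/matrixP => i k; rewrite !mxE (ord1 k) eqxx andbT ltnS.
  have [->|ij] := eqVneq i j; first by rewrite leqnn ltnn mulr1 subrKC.
  by rewrite mulr0 addr0 leq_eqVlt (inj_eq val_inj) (negbTE ij).
have z0 : z 0%N = y by apply/matrixP => i k; rewrite !mxE (ord1 k).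
have zn : z n = x by apply/matrixP => i k; rewrite !mxE (ord1 k) ltn_ord.
have step (j : 'I_n) :
    `|F (z j.+1) - F (z j) - (x j 0 - y j 0) *: (A *m delta_mx j 0)|
      <= L * rho * `|x - y|.
  have xyj : `|x j 0 - y j 0| <= `|x - y|.
    by have := entry_le_norm _ _ (x - y) j 0; rewrite !mxE.
  apply: (@le_trans _ _ (L * rho * `|x j 0 - y j 0|)); last first.
    by rewrite ler_wpM2l// mulr_ge0.
  have [a0|a0] := leP 0 (x j 0 - y j 0).
    by rewrite (ger0_norm a0) zS; apply: along => //; rewrite -zS.
  have a'0 : 0 <= - (x j 0 - y j 0) by rewrite oppr_ge0 ltW.
  have zE : z j = z j.+1 + - (x j 0 - y j 0) *: delta_mx j 0.
    by rewrite zS scaleNr addrK.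
  have := along (z j.+1) _ j a'0 (zr _); rewrite -zE => /(_ (zr _)).
  rewrite (ltr0_norm a0) scaleNr opprK => H; apply: le_trans H.
  by rewrite -[leLHS]normrN opprD opprB opprK.
have -> : F x - F y - A *m (x - y) = \sum_(j < n)
    (F (z j.+1) - F (z j) - (x j 0 - y j 0) *: (A *m delta_mx j 0)).
  rewrite sumrB -(big_mkord xpredT (fun j => F (z j.+1) - F (z j))).
  rewrite telescope_sumr// z0 zn {1}(col_sum_delta _ (x - y)) mulmx_sumr.
  by congr (_ - _); apply: eq_bigr => j _; rewrite scalemxAr !mxE.
apply: le_trans (ler_norm_sum _ _ _) _.
apply: (@le_trans _ _ (\sum_(j < n) L * rho * `|x - y|)).
  by apply: ler_sum => j _; exact: step.
by rewrite sumr_const card_ord -[leLHS]mulr_natl !mulrA.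
Qed.


Lemma jacobian_of_quadratic_error F (xs : V) (A : 'M[R]_n) (C d : R) :
  0 <= C -> 0 < d ->
  (forall x, `|x - xs| < d ->
     `|F x - F xs - A *m (x - xs)| <= C * `|x - xs| * `|x - xs|) ->
  differentiable F xs /\ jacobian_mx F xs = A.
Proof.
move=> C0 d0 FA.
have contA : continuous (mulmx A : V -> V).
  apply/linear_bounded_continuous/bounded_funP => r.
  exists (n%:R * `|A| * r) => x xr; apply: le_trans (norm_mulmx_le _ _ _ _ _) _.
  by rewrite ler_wpM2l// mulr_ge0.
have small (r : R) : 0 < r -> \forall h \near (0 : V),
    `|F (h + xs) - (F xs + A *m h)| <= r * `|h|.
  move=> r0; apply/nbhs_ballP.
  exists (Num.min d (r / (C + 1))) => /= [|h].
    by rewrite lt_min d0 divr_gt0// ltr_wpDl.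
  rewrite -ball_normE /= sub0r normrN lt_min => /andP[hd hr].
  have := FA (h + xs); rewrite addrK => /(_ hd).
  rewrite opprD addrA => /le_trans; apply; rewrite ler_wpM2r//.
  rewrite ltr_pdivlMr ?ltr_wpDl// in hr.
  have := normr_ge0 h; nra.
have dE : 'd F xs = mulmx A :> (V -> V).
  by apply: diff_unique => //; apply/eqaddoP.
split; first by apply/diff_locallyP; rewrite dE; split=> //; apply/eqaddoP.
by apply/matrixP => i j; rewrite mxE dE -colE mxE.
Qed.

End StrictEstimate.

(** * A linear rate for a sequence governed by two registers *)

Section InterlockedRate.
Context {R : realType}.
Implicit Types (e X Y : nat -> R).

Lemma bernoulli_le (x : R) m : 0 <= x <= 1 -> 1 - m%:R * x <= (1 - x) ^+ m.
Proof.
move=> /andP[x0 x1]; elim: m => [|m IH]; first by rewrite mul0r subr0.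
rewrite exprS -natr1; have : 0 <= m%:R * x by rewrite mulr_ge0.
move: IH; set y := (1 - x) ^+ m; set z := m%:R * x; rewrite mulrDl -/z; nra.
Qed.

(** By Bernoulli's inequality w = 1 - (1 - kappa) / m works. *)
Lemma root_of_rate (kappa : R) m : 0 < kappa < 1 -> (0 < m)%N ->
  exists2 w : R, 0 < w < 1 & kappa <= w ^+ m.
Proof.
move=> /andP[k0 k1] m0; have m1 : 1 <= m%:R :> R by rewrite ler1n.
have mp : 0 < m%:R :> R by rewrite ltr0n.
pose x := (1 - kappa) / m%:R.
have x0 : 0 < x by rewrite divr_gt0// subr_gt0.
have mx : m%:R * x = 1 - kappa by rewrite mulrC divfK// gt_eqF.
have x1 : x < 1 by nra.
exists (1 - x); first by rewrite subr_gt0 x1 ltrBlDr ltrDl x0.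
have := @bernoulli_le x m; rewrite mx (ltW x0) (ltW x1) => /(_ isT); lra.
Qed.

Lemma geometric_small (c r : R) : 0 <= c < 1 -> 0 < r ->
  exists N, forall k, (N <= k)%N -> c ^+ k <= r.
Proof.
move=> /andP[c0 c1] r0.
have /cvgrPdist_le/(_ r r0) : (fun k => c ^+ k) @ \oo --> 0.
  by apply: cvg_expr; rewrite ger0_norm.
case=> N _ H; exists N => k /H /=.
by rewrite sub0r normrN normrX ger0_norm.
Qed.

Variables (c kappa D : R).

(** Model of a blind or educated step: it contracts the register X, which then
    bounds e, while e may grow by the factor D and Y may shrink, but by no more
    than the factor kappa. *)
Definition reset_step e X Y k : Prop :=
  [/\ X k.+1 <= c * X k, e k.+1 <= D * e k, e k.+1 <= D * X k.+1 &
      kappa * Y k <= Y k.+1 <= Y k].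

(** Model of a safeguard step, which contracts e.  The registers may shrink by
    kappa because one of them will carry a geometrically decaying term. *)
Definition contraction_step e X Y k : Prop :=
  [/\ e k.+1 <= kappa * e k, kappa * X k <= X k.+1 <= X k &
      kappa * Y k <= Y k.+1 <= Y k].

Definition interlocked e X Y k : Prop :=
  [\/ reset_step e X Y k, reset_step e Y X k | contraction_step e X Y k].

Lemma interlocked_sym e X Y k : interlocked e X Y k -> interlocked e Y X k.
Proof. by case=> [?|?|[? ? ?]]; [apply: Or32|apply: Or31|apply: Or33]. Qed.

Hypotheses (c01 : 0 < c < 1) (kappa01 : 0 < kappa < 1) (D1 : 1 <= D).
Variables (e X Y : nat -> R) (N : nat).
Hypothesis pos : forall k, (N <= k)%N -> [/\ 0 < e k, 0 < X k & 0 < Y k].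

Lemma interlocked_nonincreasing k : (N <= k)%N ->
  (forall j, (N <= j)%N -> interlocked e X Y j) -> Y k <= Y N.
Proof.
move=> Nk H; rewrite -(subnKC Nk); elim: (k - N)%N => [|i IH]; first by rewrite addn0.
have Ni := leq_addr i N; rewrite addnS; apply: le_trans IH.
have [_ _ Y0] := pos _ Ni; have /andP[c0 c1] := c01.
have [[_ _ _ /andP[]]|[YY _ _ _]|[_ _ /andP[]]] := H _ Ni => //.
by apply: le_trans YY _; rewrite ler_piMl ?ltW.
Qed.

(** Contracting Y by c compensates, in Y ^+ p, the growth of e by D; a step
    resetting X gives the inequality directly, as X then bounds e. *)
Lemma interlocked_cross p (C : R) : D * c ^+ p <= kappa ->
  D * Y N ^+ p <= C -> e N * Y N ^+ p <= C * X N ->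
  (forall j, (N <= j)%N -> interlocked e X Y j) ->
  forall k, (N <= k)%N -> e k * Y k ^+ p <= C * X k.
Proof.
move=> Dc C1 C2 H k Nk; rewrite -(subnKC Nk).
have /andP[k0 k1] := kappa01; have /andP[c0 c1] := c01.
have D0 : 0 < D by exact: lt_le_trans D1.
elim: (k - N)%N => [|i IH]; first by rewrite addn0.
have Ni := leq_addr i N; rewrite addnS; have Hi := H _ Ni.
have [e0 X0 Y0] := pos _ Ni; have [e'0 X'0 Y'0] := pos _ (leqW Ni).
have Y'N : Y (N + i).+1 <= Y N.
  by apply: interlocked_nonincreasing => //; exact: leqW.
have [_ _ YN0] := pos _ (leqnn N).
have C0 : 0 <= C by apply: le_trans C1; rewrite mulr_ge0 ?exprn_ge0 ?ltW.
case: Hi => [[_ _ eDX _]|[YY eD _ /andP[XX _]]|[ee /andP[XX _] /andP[_ YY]]].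
- apply: (@le_trans _ _ (D * X (N + i).+1 * Y N ^+ p)).
    apply: ler_pM => //; [exact: ltW|by rewrite exprn_ge0// ltW|].
    by rewrite lerXn2r// nnegrE ltW.
  by rewrite mulrAC ler_wpM2r// ltW.
- apply: (@le_trans _ _ (D * e (N + i) * (c * Y (N + i)) ^+ p)).
    apply: ler_pM => //; [exact: ltW|by rewrite exprn_ge0// ltW|].
    by rewrite lerXn2r// nnegrE ?mulr_ge0 ?ltW.
  apply: (@le_trans _ _ (kappa * (C * X (N + i)))); last first.
    by rewrite mulrCA ler_wpM2l.
  rewrite exprMn mulrACA; apply: ler_pM => //; rewrite ?mulr_ge0 ?exprn_ge0 ?ltW//.
- apply: (@le_trans _ _ (kappa * e (N + i) * Y (N + i) ^+ p)).
    apply: ler_pM => //; [exact: ltW|by rewrite exprn_ge0// ltW|].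
    by rewrite lerXn2r// nnegrE ltW.
  apply: (@le_trans _ _ (kappa * (C * X (N + i)))); last first.
    by rewrite mulrCA ler_wpM2l.
  by rewrite -mulrA ler_wpM2l// ltW.
Qed.

(** e is bounded by the register that was reset last. *)
Lemma interlocked_max (C : R) : D <= C -> e N <= C * X N ->
  (forall j, (N <= j)%N -> interlocked e X Y j) ->
  forall k, (N <= k)%N -> e k <= C * X k \/ e k <= C * Y k.
Proof.
move=> DC C1 H k Nk; rewrite -(subnKC Nk).
have /andP[k0 k1] := kappa01.
have D0 : 0 < D by exact: lt_le_trans D1.
have C0 : 0 < C by exact: lt_le_trans DC.
elim: (k - N)%N => [|i IH]; first by rewrite addn0; left.
have Ni := leq_addr i N; rewrite addnS; have Hi := H _ Ni.
have [_ X'0 Y'0] := pos _ (leqW Ni).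
case: Hi => [[_ _ eDX _]|[_ _ eDX _]|[ee /andP[XX _] /andP[YY _]]].
- by left; apply: le_trans eDX _; rewrite ler_wpM2r// ltW.
- by right; apply: le_trans eDX _; rewrite ler_wpM2r// ltW.
case: IH => IH; [left|right]; apply: le_trans ee _.
  apply: (@le_trans _ _ (kappa * (C * X (N + i)))).
    by rewrite ler_wpM2l// ltW.
  by rewrite mulrCA ler_wpM2l// ltW.
apply: (@le_trans _ _ (kappa * (C * Y (N + i)))).
  by rewrite ler_wpM2l// ltW.
by rewrite mulrCA ler_wpM2l// ltW.
Qed.

(** Every kind of step multiplies this product by at most kappa. *)
Lemma interlocked_product p (C : R) : D * c ^+ p <= kappa ->
  e N * (X N * Y N) ^+ p <= C * kappa ^+ N ->
  (forall j, (N <= j)%N -> interlocked e X Y j) ->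
  forall k, (N <= k)%N -> e k * (X k * Y k) ^+ p <= C * kappa ^+ k.
Proof.
move=> Dc C1 H k Nk; rewrite -(subnKC Nk).
have /andP[k0 k1] := kappa01; have /andP[c0 c1] := c01.
have D0 : 0 < D by exact: lt_le_trans D1.
elim: (k - N)%N => [|i IH]; first by rewrite addn0.
have Ni := leq_addr i N; rewrite addnS; have Hi := H _ Ni.
have [e0 X0 Y0] := pos _ Ni; have [e'0 X'0 Y'0] := pos _ (leqW Ni).
apply: (@le_trans _ _ (kappa * (e (N + i) * (X (N + i) * Y (N + i)) ^+ p))); last first.
  by rewrite exprS [leRHS]mulrCA ler_wpM2l// ltW.
rewrite mulrA.
have reset : e (N + i).+1 <= D * e (N + i) ->
    X (N + i).+1 * Y (N + i).+1 <= c * (X (N + i) * Y (N + i)) ->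
    e (N + i).+1 * (X (N + i).+1 * Y (N + i).+1) ^+ p
      <= kappa * e (N + i) * (X (N + i) * Y (N + i)) ^+ p.
  move=> eD XY; apply: (@le_trans _ _
      (D * e (N + i) * (c * (X (N + i) * Y (N + i))) ^+ p)).
    apply: ler_pM => //; [exact: ltW|by rewrite exprn_ge0// ltW ?mulr_gt0|].
    by rewrite lerXn2r// nnegrE ltW ?mulr_gt0.
  rewrite [in leLHS]exprMn mulrACA -[leRHS]mulrA ler_wpM2r//.
  by apply: mulr_ge0; [exact: ltW | apply/exprn_ge0/mulr_ge0; exact: ltW].
case: Hi => [[XX eD _ /andP[_ YY]]|[YY eD _ /andP[_ XX]]|[ee /andP[_ XX] /andP[_ YY]]].
- by apply: reset => //; rewrite mulrA ler_pM // ltW.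
- by apply: reset => //; rewrite mulrCA ler_pM // ltW.
- apply: ler_pM => //; [exact: ltW|by rewrite exprn_ge0// ltW ?mulr_gt0|].
  rewrite lerXn2r ?nnegrE ?(ltW (mulr_gt0 _ _))//.
  by rewrite ler_pM // ltW.
Qed.

End InterlockedRate.

(** With f = e / C the hypotheses give X >= f and Y >= f^(p+1), hence
    f (X Y)^p >= f^(1 + p + p (p+1)) = f^((p+1)^2). *)
Lemma combine_interlocked {R : realType} (e X Y C r : R) p :
  0 < e -> 0 < X -> 0 < Y -> 1 <= C ->
  e <= C * X -> e * X ^+ p <= C * Y -> e * (X * Y) ^+ p <= C * r ->
  (e / C) ^+ (p.+1 * p.+1) <= r.
Proof.
move=> e0 X0 Y0 C1 eX eY eXY.
have C0 : 0 < C by exact: lt_le_trans C1.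
pose f := e / C; have f0 : 0 < f by rewrite divr_gt0.
have fX : f <= X by rewrite ler_pdivrMr// mulrC.
have fY : f ^+ p.+1 <= Y.
  apply: (@le_trans _ _ (f * X ^+ p)).
    by rewrite exprS ler_wpM2l ?(ltW f0)// lerXn2r// nnegrE ltW.
  by rewrite /f mulrAC ler_pdivrMr// [leRHS]mulrC.
apply: (@le_trans _ _ (f * (X * Y) ^+ p)); last first.
  by rewrite /f mulrAC ler_pdivrMr// [leRHS]mulrC.
rewrite -/f mulSn exprD exprS -mulrA ler_wpM2l ?(ltW f0)// [leRHS]exprMn.
rewrite mulnC exprM; apply: ler_pM; rewrite ?exprn_ge0 ?(ltW f0)//.
  by rewrite lerXn2r// nnegrE ltW.
by rewrite lerXn2r// nnegrE ?exprn_ge0 ?ltW.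
Qed.

(** The exponent p makes p contractions of a register compensate one growth of
    e; C is a common bound for all the initial values. *)
Lemma interlocked_linear_rate {R : realType} (c kappa D : R) (e X Y : nat -> R) N :
  0 < c < 1 -> 0 < kappa < 1 -> 1 <= D ->
  (forall k, (N <= k)%N -> [/\ 0 < e k, 0 < X k & 0 < Y k]) ->
  (forall k, (N <= k)%N -> interlocked c kappa D e X Y k) ->
  exists C w : R, [/\ 0 < C, 0 < w < 1 &
    forall k, (N <= k)%N -> e k <= C * w ^+ k].
Proof.
move=> c01 k01 D1 pos H.
have /andP[c0 c1] := c01; have /andP[k0 k1] := k01.
have D0 : 0 < D by exact: lt_le_trans D1.
have [p cp] : exists p, c ^+ p <= kappa / D.
  have [//||p pP] := geometric_small c (kappa / D); rewrite ?(ltW c0) ?divr_gt0//.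
  by exists p; apply: pP.
have {}cp : D * c ^+ p <= kappa by rewrite mulrC -ler_pdivlMr.
have pos' k : (N <= k)%N -> [/\ 0 < e k, 0 < Y k & 0 < X k] by case/pos.
have H' k : (N <= k)%N -> interlocked c kappa D e Y X k.
  by move=> Nk; apply: interlocked_sym; exact: H.
have [eN XN YN] := pos _ (leqnn N).
pose C := D + D * Y N ^+ p + D * X N ^+ p + e N / X N + e N * Y N ^+ p / X N
  + e N * X N ^+ p / Y N + e N * (X N * Y N) ^+ p / kappa ^+ N.
have [p1 p2 p3 p4] : [/\ 0 <= D * Y N ^+ p, 0 <= D * X N ^+ p, 0 <= e N / X N &
    0 <= e N * Y N ^+ p / X N].
  by split; do ?[apply: divr_ge0|apply: mulr_ge0|apply: exprn_ge0]; exact: ltW.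
have [p5 p6] : 0 <= e N * X N ^+ p / Y N /\
    0 <= e N * (X N * Y N) ^+ p / kappa ^+ N.
  by split; do ?[apply: divr_ge0|apply: mulr_ge0|apply: exprn_ge0]; exact: ltW.
have CD : D <= C by rewrite /C; lra.
have C1 : 1 <= C := le_trans D1 CD.
have C0 : 0 < C by exact: lt_le_trans C1.
have [w w01 kw] := @root_of_rate _ _ (p.+1 * p.+1) k01 isT.
exists C, w; split=> // k Nk.
have /andP[w0 _] := w01.
have [ek Xk Yk] := pos _ Nk.
have max := interlocked_max c kappa D k01 D1 e X Y N pos C CD.
have crossX := interlocked_cross c kappa D c01 k01 D1 e X Y N pos p C cp.
have crossY := interlocked_cross c kappa D c01 k01 D1 e Y X N pos' p C cp.
have prod := interlocked_product c kappa D c01 k01 D1 e X Y N pos p C cp.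
have {}max : e k <= C * X k \/ e k <= C * Y k.
  by apply: max => //; rewrite -ler_pdivrMr// /C; lra.
have {}crossX : e k * Y k ^+ p <= C * X k.
  by apply: crossX => //; rewrite -?ler_pdivrMr// /C; lra.
have {}crossY : e k * X k ^+ p <= C * Y k.
  by apply: crossY => //; rewrite -?ler_pdivrMr// /C; lra.
have {}prod : e k * (X k * Y k) ^+ p <= C * kappa ^+ k.
  by apply: prod => //; rewrite -?ler_pdivrMr ?exprn_gt0// /C; lra.
have : (e k / C) ^+ (p.+1 * p.+1) <= kappa ^+ k.
  case: max => H1; first exact: (combine_interlocked _ (X k) (Y k)).
  by apply: (combine_interlocked _ (Y k) (X k)) => //; rewrite [Y k * _]mulrC.
move=> ekC; rewrite mulrC -ler_pdivrMr//.
have f0 : 0 <= e k / C by rewrite divr_ge0// ltW.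
rewrite -(@ler_pXn2r _ (p.+1 * p.+1)) ?nnegrE ?exprn_ge0 ?(ltW w0)//.
apply: le_trans ekC _; rewrite -exprM mulnC exprM.
by rewrite lerXn2r// nnegrE ?exprn_ge0 ?ltW.
Qed.

(** * Averaged operators and the safeguard step *)

Section Distance.
Context {R : realType} {n : nat} (ip : {dot 'cV[R]_n for idfun}).
Local Notation V := 'cV[R]_n.
Local Notation nrm := (hnorm ip).
Variable A : set V.
Hypothesis A0 : A !=set0.
Implicit Types x y z : V.

Lemma dist_le x z : A z -> dist ip x A <= nrm (x - z).
Proof.
move=> Az; apply: ge_inf; last by exists z.
by exists 0 => _ [y _ <-]; exact: hnorm_ge0.
Qed.

Lemma le_dist (a : R) x : (forall z, A z -> a <= nrm (x - z)) -> a <= dist ip x A.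
Proof.
move=> H; apply: lb_le_inf => [|_ [z Az <-]]; last exact: H.
by case: A0 => z Az; exists (nrm (x - z)), z.
Qed.

Lemma dist_ge0 x : 0 <= dist ip x A.
Proof. by apply: le_dist => z _; exact: hnorm_ge0. Qed.

Lemma dist_step x y : dist ip y A <= dist ip x A + nrm (y - x).
Proof.
rewrite -lerBlDr; apply: le_dist => z Az; rewrite lerBlDr.
by have := dist_le y _ Az; have := ler_hdistD ip y x z; lra.
Qed.

Lemma dist_sqr_decrease (b : R) x y : 0 <= b ->
  (forall z, A z -> nrm (y - z) ^+ 2 <= nrm (x - z) ^+ 2 - b) ->
  dist ip y A ^+ 2 <= dist ip x A ^+ 2 - b.
Proof.
move=> b0 H; rewrite lerBrDr.
have s0 : 0 <= dist ip y A ^+ 2 + b by rewrite addr_ge0 ?sqr_ge0.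
rewrite -(sqr_sqrtr s0) ler_sqr ?nnegrE ?sqrtr_ge0 ?dist_ge0//.
apply: le_dist => z Az; rewrite -ler_sqr ?nnegrE ?sqrtr_ge0 ?hnorm_ge0//.
rewrite sqr_sqrtr// -lerBrDr; apply: le_trans (H _ Az).
by rewrite ler_sqr ?nnegrE ?dist_ge0 ?hnorm_ge0// dist_le.
Qed.

Lemma fejer_step_le_dist x y :
  (forall z, A z -> nrm (y - z) <= nrm (x - z)) -> nrm (y - x) <= 2 * dist ip x A.
Proof.
move=> H; rewrite mulrC -ler_pdivrMr//; apply: le_dist => z Az.
rewrite ler_pdivrMr//; have := ler_hdistD ip y z x.
have := H z Az; rewrite (hnorm_distC ip z x); lra.
Qed.

End Distance.

Section AveragedResidual.
Context {R : realType} {n : nat} (ip : {dot 'cV[R]_n for idfun}).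
Local Notation V := 'cV[R]_n.
Local Notation nrm := (hnorm ip).
Variables (T : V -> V) (alpha : R).
Hypotheses (halpha : 0 < alpha <= 1) (hT : averaged ip alpha T).
Local Notation F := (residual T).
Implicit Types x y z w : V.

Lemma residual_lipschitz x y : nrm (F x - F y) <= 2 * nrm (x - y).
Proof.
have [S [Sne TE]] := hT; have /andP[a0 a1] := halpha.
have -> : F x - F y = alpha *: ((x - y) - (S x - S y)).
  by rewrite /residual !TE; apply/matrixP => i j; rewrite !mxE; ring.
rewrite hnormZ gtr0_norm//; have := ler_hnormB ip (x - y) (S x - S y).
have := Sne x y; have := hnorm_ge0 ip (x - y); have := hnorm_ge0 ip (x - y - (S x - S y)).
nra.
Qed.

(** F is alpha times (id - S) with S nonexpansive, and z is fixed by S: expand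
    |S w - z|^2 <= |w - z|^2. *)
Lemma residual_cocoercive w z : F z = 0 ->
  nrm (F w) ^+ 2 <= 2 * alpha * ip (F w) (w - z).
Proof.
have [S [Sne TE]] := hT; have /andP[a0 a1] := halpha => Fz.
have Sz : S z = z.
  have : alpha *: (z - S z) = 0.
    by rewrite -[RHS]Fz /residual TE; apply/matrixP => i j; rewrite !mxE; ring.
  by move=> /eqP; rewrite scaler_eq0 gt_eqF//= subr_eq0 => /eqP.
have FE : F w = alpha *: ((w - z) - (S w - z)).
  by rewrite /residual !TE; apply/matrixP => i j; rewrite !mxE; ring.
have : nrm (S w - z) ^+ 2 <= nrm (w - z) ^+ 2.
  by rewrite ler_sqr ?nnegrE ?hnorm_ge0// -{1}Sz.
rewrite FE !sqr_hnorm; move: (w - z) (S w - z) => u v.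
rewrite !ipE (ip_sym ip v u) => H.
have : 0 <= alpha * alpha * (ip u u - ip v v).
  by rewrite mulr_ge0 ?subr_ge0// mulr_ge0 ?ltW.
nra.
Qed.

(** Cocoercivity puts every zero of F in the half space of the z with
    r <= 2 alpha <F w, x - z>; the new point is a relaxed projection of x onto
    it, and the acceptance test makes the displacement comparable with |F x|. *)
Lemma safeguard_fejer (lam sig : R) x w z : F z = 0 -> F w <> 0 ->
  let r := nrm (F w) ^+ 2 - 2 * alpha * ip (F w) (w - x) in
  0 < lam < alpha^-1 -> 0 < sig -> sig * nrm (F w) * nrm (F x) <= r ->
  nrm (x - (lam * (r / nrm (F w) ^+ 2)) *: F w - z) ^+ 2
    <= nrm (x - z) ^+ 2 - lam * (alpha^-1 - lam) * sig ^+ 2 * nrm (F x) ^+ 2.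
Proof.
move=> Fz Fw0 r /andP[l0 la] s0 hr; have /andP[a0 a1] := halpha.
have v0 : 0 < nrm (F w) by rewrite hnorm_gt0; exact/eqP.
pose t := r / nrm (F w).
have tx : sig * nrm (F x) <= t by rewrite ler_pdivlMr// mulrAC.
have rE : r = t * nrm (F w) by rewrite divfK// gt_eqF.
have halfspace : r <= 2 * alpha * ip (F w) (x - z).
  have := residual_cocoercive w _ Fz; rewrite /r.
  have -> : w - z = (w - x) + (x - z) by rewrite addrA subrK.
  by rewrite ipDr; lra.
have -> : lam * (r / nrm (F w) ^+ 2) = lam * t / nrm (F w).
  by rewrite rE; field; rewrite gt_eqF.
have -> : x - (lam * t / nrm (F w)) *: F w - z
        = (x - z) - (lam * t / nrm (F w)) *: F w by rewrite addrAC.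
have -> : nrm (x - z - (lam * t / nrm (F w)) *: F w) ^+ 2 =
   nrm (x - z) ^+ 2 - 2 * (lam * t / nrm (F w)) * ip (F w) (x - z) + (lam * t) ^+ 2.
  move: (F w) (x - z) v0 => g u g0.
  rewrite sqr_hnorm (sqr_hnorm ip u) !ipE (ip_sym ip u g).
  have -> : ip g g = nrm g ^+ 2 by rewrite sqr_hnorm.
  by field; rewrite gt_eqF.
have t0 : 0 <= t by apply: le_trans tx; rewrite mulr_ge0 ?hnorm_ge0// ltW.
have H1 : t / alpha <= 2 * ip (F w) (x - z) / nrm (F w).
  rewrite ler_pdivlMr// mulrAC -rE ler_pdivrMr//.
  by apply: le_trans halfspace _; rewrite mulrAC.
have H2 : lam * t * (t / alpha) <= lam * t * (2 * ip (F w) (x - z) / nrm (F w)).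
  by rewrite ler_wpM2l// mulr_ge0// ltW.
have H3 : lam * (alpha^-1 - lam) * (sig * nrm (F x)) ^+ 2
    <= lam * (alpha^-1 - lam) * t ^+ 2.
  rewrite ler_wpM2l//; first by rewrite mulr_ge0 ?subr_ge0 ?ltW.
  by rewrite ler_sqr// nnegrE mulr_ge0 ?hnorm_ge0// ltW.
rewrite exprMn in H3.
have -> : 2 * (lam * t / nrm (F w)) * ip (F w) (x - z) =
  lam * t * (2 * ip (F w) (x - z) / nrm (F w)) by ring.
have E : lam * t * (t / alpha) = lam * alpha^-1 * t ^+ 2 by ring.
rewrite E in H2; move: H2 H3.
set P := lam * t * (2 * _ / _); set Q := nrm (x - z) ^+ 2; lra.
Qed.

Lemma residual_le_dist x : zer F !=set0 -> nrm (F x) <= 2 * dist ip x (zer F).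
Proof.
move=> Z0; rewrite mulrC -ler_pdivrMr//; apply: le_dist => // z Fz.
rewrite ler_pdivrMr// mulrC; have := residual_lipschitz x z.
by rewrite Fz subr0.
Qed.

End AveragedResidual.

(** * Linear convergence of the iterates *)

Lemma contraction_factor {R : realType} (x : R) : 0 < x ->
  exists2 k : R, 0 < k < 1 & 1 - x <= k ^+ 2.
Proof.
move=> x0; pose y := Num.min x 1.
have y0 : 0 < y by rewrite lt_min x0 ltr01.
have y1 : y <= 1 by rewrite ge_min lexx orbT.
have yx : y <= x by rewrite ge_min lexx.
by exists (1 - y / 2); [lra | nra].
Qed.

(** Telescoping: the total length of the path after x k is at most b k. *)
Lemma dist_to_limit {R : realType} {n : nat} (ip : {dot 'cV[R]_n for idfun})
    (x : nat -> 'cV[R]_n) (xs : 'cV[R]_n) (b : nat -> R) N :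
  x @ \oo --> xs -> (forall k, (N <= k)%N -> 0 <= b k) ->
  (forall k, (N <= k)%N -> hnorm ip (x k.+1 - x k) <= b k - b k.+1) ->
  forall k, (N <= k)%N -> hnorm ip (x k - xs) <= b k.
Proof.
move=> xcv b0 xb k Nk.
have [a a0 aN] := hnorm_le_norm ip.
have partial m : hnorm ip (x k - x (k + m)%N) <= b k - b (k + m)%N.
  elim: m => [|m IH]; first by rewrite addn0 !subrr hnorm0.
  have := ler_hdistD ip (x k) (x (k + m)%N) (x (k + m).+1).
  have := xb _ (leq_trans Nk (leq_addr m k)).
  rewrite hnorm_distC addnS; lra.
apply/ler_addgt0Pr => r r0.
have ra0 : 0 < r / a by rewrite divr_gt0.
have [m _ mP] := (@cvgrPdist_lt _ _ _ _ _ _ _).1 xcv _ ra0.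
have := mP (k + m)%N (leq_addl _ _); rewrite /= distrC => xm.
have {}xm : hnorm ip (x (k + m)%N - xs) < r.
  by apply: le_lt_trans (aN _) _; rewrite mulrC -ltr_pdivlMr.
have := ler_hdistD ip (x k) (x (k + m)%N) xs; have := partial m.
have := b0 _ (leq_trans Nk (leq_addr m k)); lra.
Qed.

Section Run.
Context {R : realType} {n : nat} (ip : {dot 'cV[R]_n for idfun}).
Local Notation V := 'cV[R]_n.
Local Notation nrm := (hnorm ip).
Variables (T : V -> V) (alpha : R).
Hypotheses (halpha : 0 < alpha <= 1) (hT : averaged ip alpha T)
  (hfix : fix_set T !=set0).
Variables (p : supermann_params R) (s : supermann_run R n).
Hypotheses (hp : valid_params alpha p) (hs : supermann_scheme ip T alpha p s)
  (hns : never_solved T p s).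
Local Notation F := (residual T).
Local Notation x_ := (iter_x s).
Local Notation r k := (nrm (F (x_ k))).
Local Notation e k := (dist ip (x_ k) (zer F)).

Lemma zer_residual_neq0 : zer F !=set0.
Proof. by case: hfix => z Tz; exists z; rewrite /zer /residual /= Tz subrr. Qed.

Lemma residual_gt0 k : 0 < r k.
Proof. by rewrite hnorm_gt0; apply/eqP; case: hns => + _; apply. Qed.

Lemma candidate_residual_neq0 k : F (w_ p s k) <> 0.
Proof. by case: hns => _; apply. Qed.

Lemma beta_pow_le1 j : 0 <= beta p ^+ j <= 1.
Proof.
have [_ _ _ [/andP[b0 b1] _ _]] := hp.
by rewrite exprn_ge0 ?exprn_ile1// ltW.
Qed.

Lemma w_step k : nrm (w_ p s k - x_ k) <= nrm (dir s k).
Proof.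
rewrite /w_ /candidate addrC addKr hnormZ.
have /andP[b0 b1] := beta_pow_le1 (backtracks s k).
by rewrite ger0_norm// ler_piMl// hnorm_ge0.
Qed.

Lemma eta_gt0 k : 0 < eta s k.
Proof.
have [eta0 _ step] := hs.
elim: k => [|k IH]; first by rewrite eta0; exact: residual_gt0.
by have [[_ [_ -> _ _]]|[_ _ [-> _ _]]|[_ _ [-> _ _]]] := step k;
  rewrite ?residual_gt0.
Qed.

Lemma rsafe_gt0 k : 0 < rsafe s k.
Proof.
have [_ rs0 step] := hs.
elim: k => [|k IH]; first by rewrite rs0; exact: residual_gt0.
have [[_ [_ _ -> _]]|[_ _ [_ -> _]]|[_ _ [_ -> _]]] := step k => //.
have [_ _ /andP[q0 _] _] := hp.
rewrite ltr_pwDl ?exprn_ge0// hnorm_gt0; apply/eqP.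
exact: candidate_residual_neq0.
Qed.

Lemma residual_le_2dist k : r k <= 2 * e k.
Proof. exact: residual_le_dist halpha hT _ zer_residual_neq0. Qed.

Lemma dist_gt0 k : 0 < e k.
Proof. by have := residual_le_2dist k; have := residual_gt0 k; lra. Qed.

Variables (M gam : R) (N : nat).
Hypotheses (M0 : 0 <= M) (dirM : forall k, nrm (dir s k) <= M * r k)
  (gam0 : 0 < gam) (subreg : forall k, (N <= k)%N -> e k <= gam * r k).

Lemma safeguard_decrease k : K2 ip T alpha p s k -> safeguard_step ip T alpha p s k ->
  forall z, zer F z ->
  nrm (x_ k.+1 - z) ^+ 2 <= nrm (x_ k - z) ^+ 2
    - lambda p * (alpha^-1 - lambda p) * sigma p ^+ 2 * r k ^+ 2.
Proof.
move=> /and3P[_ _ sg] [_ _ ->] z Fz.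
have [_ _ _ [_ /andP[sig0 _] lam]] := hp.
by apply: (safeguard_fejer _ _ _ halpha hT); rewrite //; exact: candidate_residual_neq0.
Qed.

Lemma safeguard_gain_gt0 : 0 < lambda p * (alpha^-1 - lambda p) * sigma p ^+ 2.
Proof.
have [_ _ _ [_ /andP[sig0 _] /andP[l0 la]]] := hp.
by rewrite !mulr_gt0 ?exprn_gt0 ?subr_gt0.
Qed.

(** For a safeguard step, Fejer monotonicity already bounds the displacement by
    twice the distance. *)
Lemma step_le_dist k : nrm (x_ k.+1 - x_ k) <= (2 * M + 2) * e k.
Proof.
have [_ _ step] := hs; have e0 := ltW (dist_gt0 k).
have quasi : x_ k.+1 = w_ p s k -> nrm (x_ k.+1 - x_ k) <= (2 * M + 2) * e k.
  move=> ->; apply: le_trans (w_step k) _; apply: le_trans (dirM k) _.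
  have : M * r k <= M * (2 * e k) by rewrite ler_wpM2l// residual_le_2dist.
  lra.
have [[_ [_ _ _ /quasi//]]|[_ _ [_ _ /quasi//]]|[k2 _ sg]] := step k.
apply: (@le_trans _ _ (2 * e k)); last by have := mulr_ge0 M0 e0; lra.
apply: fejer_step_le_dist; first exact: zer_residual_neq0.
move=> z Fz; have := safeguard_decrease k k2 sg z Fz.
have := safeguard_gain_gt0 => g0 H.
rewrite -ler_sqr ?nnegrE ?hnorm_ge0//; apply: le_trans H _.
by rewrite lerBlDr lerDl mulr_ge0 ?sqr_ge0// ltW.
Qed.

(** The second register is rsafe k + A q'^k rather than rsafe k: the term q^k
    added by an educated step is then absorbed by the decay of A q'^k. *)
Lemma supermann_linear_rate : exists C w : R, [/\ 0 < C, 0 < w < 1 &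
    forall k, (N <= k)%N -> e k <= C * w ^+ k].
Proof.
have [/andP[c00 c01] /andP[c10 c11] /andP[q0 q1] _] := hp.
have [_ _ step] := hs.
have g0 := safeguard_gain_gt0.
set g := lambda p * _ * _ in g0.
have [k0 /andP[k00 k01] k0P] : exists2 k : R, 0 < k < 1 & 1 - g / gam ^+ 2 <= k ^+ 2.
  by apply: contraction_factor; rewrite divr_gt0// exprn_gt0.
pose q' := Num.max (q p) k0.
have q'0 : 0 < q' by rewrite lt_max k00 orbT.
have q'1 : q' < 1 by rewrite gt_max q1 k01.
have qq' : q p <= q' by rewrite le_max lexx.
have k0q' : k0 <= q' by rewrite le_max lexx orbT.
pose A := 2 / (1 - q').
have A0 : 0 < A by rewrite divr_gt0// subr_gt0.
have AE : 1 + A * q' = A * ((1 + q') / 2).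
  by rewrite /A; field; rewrite subr_eq0 gt_eqF.
pose c := Num.max (Num.max (c0 p) (c1 p)) ((1 + q') / 2).
have cc0 : c0 p <= c by rewrite !le_max lexx.
have cc1 : c1 p <= c by rewrite !le_max lexx orbT.
have cq : (1 + q') / 2 <= c by rewrite !le_max lexx !orbT.
have c_gt0 : 0 < c by apply: lt_le_trans cq; lra.
have c_lt1 : c < 1 by rewrite !gt_max c01 c11 /=; lra.
pose D := 1 + 2 * M + gam.
(* A is chosen so that 1 + A q' = A (1 + q') / 2, see AE *)
pose S k := rsafe s k + A * q' ^+ k.
have S0 k : 0 < S k.
  by apply: addr_gt0; [exact: rsafe_gt0 | rewrite mulr_gt0 ?exprn_gt0].
have Skeep k : rsafe s k.+1 = rsafe s k -> q' * S k <= S k.+1 <= S k.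
  move=> E; rewrite /S E exprS; have := rsafe_gt0 k.
  have : 0 < A * q' ^+ k by rewrite mulr_gt0 ?exprn_gt0.
  rewrite mulrCA; set u := A * _ => u0 v0.
  by apply/andP; split; nra.
have etakeep k : eta s k.+1 = eta s k -> q' * eta s k <= eta s k.+1 <= eta s k.
  move=> ->; rewrite lexx andbT ler_piMl ?ltW ?eta_gt0//.
have rS k : rsafe s k <= S k.
  by rewrite lerDl mulr_ge0 ?exprn_ge0 ?ltW.
have quasi k : x_ k.+1 = w_ p s k -> e k.+1 <= e k + M * r k.
  move=> xE; apply: le_trans (dist_step ip _ zer_residual_neq0 (x_ k) _) _.
  by rewrite lerD2l xE; apply: le_trans (w_step k) _.
have quasiD k : x_ k.+1 = w_ p s k -> e k.+1 <= D * e k.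
  move=> /quasi H; apply: le_trans H _.
  have : M * r k <= M * (2 * e k) by rewrite ler_wpM2l// residual_le_2dist.
  have : 0 <= gam * e k by rewrite mulr_ge0 ?ltW// dist_gt0.
  rewrite /D; lra.
apply: (@interlocked_linear_rate _ c q' D (fun k => e k) (eta s) S).
- by rewrite c_gt0.
- by rewrite q'0.
- by rewrite /D; move: M0 gam0; lra.
- by move=> k _; split; [exact: dist_gt0|exact: eta_gt0|exact: S0].
move=> k Nk.
have [[]|[]|[]] := step k.
- move=> bl [_ etaE rsE xE]; apply: Or31; split.
  + rewrite etaE; apply: le_trans (bl : is_true (_ <= _)) _.
    by rewrite ler_wpM2r// ltW// eta_gt0.
  + exact: quasiD.
  + rewrite etaE; apply: le_trans (quasi k xE) _.
    have := subreg k Nk; have := residual_gt0 k => r0.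
    have : 0 <= M * r k by rewrite mulr_ge0 ?hnorm_ge0.
    rewrite /D; move: M0 gam0; lra.
  + exact: Skeep.
- move=> /andP[_ /andP[safe dec]] _ [etaE rsE xE]; apply: Or32.
  have decS : nrm (F (w_ p s k)) <= c1 p * r k by exact: dec.
  have qk : q p ^+ k <= q' ^+ k by rewrite lerXn2r ?nnegrE// ltW.
  split.
  + rewrite /S rsE exprS.
    have H1 : c1 p * r k <= c * rsafe s k.
      by apply: ler_pM => //; exact: hnorm_ge0.
    have H2 : q' ^+ k * (1 + A * q') <= q' ^+ k * (A * c).
      by rewrite ler_wpM2l ?exprn_ge0 ?(ltW q'0)// AE ler_wpM2l// ltW.
    move: qk H2; set t := q' ^+ k; lra.
  + exact: quasiD.
  + apply: le_trans (subreg _ (leqW Nk)) _; rewrite xE.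
    apply: (@le_trans _ _ (gam * S k.+1)).
      rewrite ler_wpM2l ?(ltW gam0)//; apply: le_trans (rS _); rewrite rsE.
      by rewrite lerDl exprn_ge0.
    by rewrite ler_wpM2r ?(ltW (S0 _))// /D; move: M0; lra.
  + exact: etakeep.
- move=> k2 _ sg; have [etaE rsE _] := sg; apply: Or33; split.
  + apply: (@le_trans _ _ (k0 * e k)); last first.
      by rewrite ler_wpM2r// ltW// dist_gt0.
    have e0 := dist_gt0 k; have e'0 := dist_gt0 k.+1.
    rewrite -ler_sqr ?nnegrE ?(ltW e'0) ?(ltW (mulr_gt0 k00 e0))//.
    have H : e k.+1 ^+ 2 <= e k ^+ 2 - g * r k ^+ 2.
      apply: dist_sqr_decrease => //; first exact: zer_residual_neq0.
        by rewrite mulr_ge0 ?sqr_ge0// ltW.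
      exact: safeguard_decrease.
    apply: le_trans H _; rewrite exprMn.
    apply: (@le_trans _ _ ((1 - g / gam ^+ 2) * e k ^+ 2)); last first.
      by rewrite ler_wpM2r ?sqr_ge0.
    have : (e k / gam) ^+ 2 <= r k ^+ 2.
      rewrite ler_sqr ?nnegrE ?hnorm_ge0 ?(ltW (divr_gt0 e0 gam0))//.
      by rewrite ler_pdivrMr// mulrC; exact: subreg.
    move=> H; have : g * (e k / gam) ^+ 2 <= g * r k ^+ 2 by rewrite ler_wpM2l// ltW.
    by rewrite expr_div_n; lra.
  + exact: etakeep.
  + exact: Skeep.
Qed.

End Run.

(** * The modified Broyden update *)

Section Euclidean.
Context {R : realType} {n : nat}.
Local Notation V := 'cV[R]_n.
Implicit Types (u v p s : V) (a : R) (E : 'M[R]_n).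

Lemma dot2E u v : dot2 u v = \sum_i u i 0 * v i 0.
Proof. by rewrite /dot2 mxE; apply: eq_bigr => i _; rewrite mxE. Qed.

Lemma dot2C u v : dot2 u v = dot2 v u.
Proof. by rewrite !dot2E; apply: eq_bigr => i _; rewrite mulrC. Qed.

Lemma dot2Dl u v p : dot2 (u + v) p = dot2 u p + dot2 v p.
Proof. by rewrite /dot2 linearD mulmxDl mxE. Qed.

Lemma dot2Zl a u v : dot2 (a *: u) v = a * dot2 u v.
Proof. by rewrite /dot2 linearZ -scalemxAl mxE. Qed.

Lemma dot2Nl u v : dot2 (- u) v = - dot2 u v.
Proof. by rewrite -scaleN1r dot2Zl mulN1r. Qed.

Lemma dot2Dr u v p : dot2 p (u + v) = dot2 p u + dot2 p v.
Proof. by rewrite dot2C dot2Dl !(dot2C _ p). Qed.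

Lemma dot2Zr a u v : dot2 v (a *: u) = a * dot2 v u.
Proof. by rewrite dot2C dot2Zl dot2C. Qed.

Lemma dot2Nr u v : dot2 v (- u) = - dot2 v u.
Proof. by rewrite dot2C dot2Nl dot2C. Qed.

Definition dot2_lin := (dot2Dl, dot2Dr, dot2Nl, dot2Nr, dot2Zl, dot2Zr).

Lemma dot2_ge0 u : 0 <= dot2 u u.
Proof. by rewrite dot2E sumr_ge0// => i _; rewrite -expr2 sqr_ge0. Qed.

Lemma sqr_norm_le_dot2 u : `|u| ^+ 2 <= dot2 u u.
Proof.
rewrite -(sqr_sqrtr (dot2_ge0 u)) ler_sqr ?nnegrE ?sqrtr_ge0//.
apply: norm_le_entries => [|i j]; first exact: sqrtr_ge0.
rewrite (ord1 j) -sqrtr_sqr ler_sqrt ?dot2_ge0// dot2E (bigD1 i)//= expr2 lerDl.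
by rewrite sumr_ge0// => k _; rewrite -expr2 sqr_ge0.
Qed.

Lemma dot2_le_sqr_norm u : dot2 u u <= n%:R * `|u| ^+ 2.
Proof.
rewrite dot2E; apply: (@le_trans _ _ (\sum_(i < n) `|u| ^+ 2)).
  apply: ler_sum => i _; rewrite -expr2 -(real_normK (num_real _)).
  by rewrite ler_sqr ?nnegrE// entry_le_norm.
by rewrite sumr_const card_ord mulr_natl.
Qed.

Lemma dot2_gt0 u : u != 0 -> 0 < dot2 u u.
Proof.
move=> u0; apply: lt_le_trans (sqr_norm_le_dot2 u).
by rewrite exprn_gt0// normr_gt0.
Qed.

(** The square of the Frobenius norm. *)
Definition frob E : R := \tr (E^T *m E).

Lemma frob_ge0 E : 0 <= frob E.
Proof.
apply: sumr_ge0 => i _; rewrite mxE sumr_ge0// => j _.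
by rewrite mxE -expr2 sqr_ge0.
Qed.

Lemma frob_rank1_update E u s : s != 0 ->
  frob (E + (dot2 s s)^-1 *: (u *m s^T)) =
  frob E + (2 * dot2 (E *m s) u + dot2 u u) / dot2 s s.
Proof.
move=> s0; have ss := dot2_gt0 _ s0.
have tr1 (A B : V) : \tr (A *m B^T) = dot2 B A.
  by rewrite mxtrace_mulC /dot2 [LHS]/mxtrace big_ord1.
have ET : (E + (dot2 s s)^-1 *: (u *m s^T))^T = E^T + (dot2 s s)^-1 *: (s *m u^T).
  by rewrite linearD linearZ /= trmx_mul trmxK.
rewrite /frob ET.
rewrite mulmxDl !mulmxDr !mxtraceD.
rewrite -!scalemxAr -!scalemxAl !mxtraceZ.
have -> : \tr (E^T *m (u *m s^T)) = dot2 (E *m s) u.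
  by rewrite mulmxA tr1 /dot2 trmx_mul mulmxA.
have -> : \tr (s *m u^T *m E) = dot2 (E *m s) u.
  by rewrite -mulmxA mxtrace_mulC -mulmxA mxtrace_mulC tr1 dot2C.
have -> : \tr (s *m u^T *m (u *m s^T)) = dot2 u u * dot2 s s.
  rewrite mulmxA -(mulmxA s) (mx11_scalar (u^T *m u)) mul_mx_scalar -scalemxAl.
  by rewrite mxtraceZ tr1.
by field; rewrite gt_eqF.
Qed.

(** With q = E s, expanding the square leaves - (2 theta - theta^2) |q|^2, the
    square of v, and a cross term 2 theta (1 - theta) <q, v>, which Young's
    inequality splits between the other two.  As theta stays within tb < 1 of 1,
    2 theta - theta^2 >= c. *)
Lemma broyden_error_decrease E s v (theta tb c : R) : s != 0 ->
  0 <= tb < 1 -> `|theta - 1| <= tb ->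
  0 < c <= 1 - tb ^+ 2 ->
  frob (E + (dot2 s s)^-1 *: ((theta *: (v - E *m s)) *m s^T))
   <= frob E - c / 2 * (dot2 (E *m s) (E *m s) / dot2 s s)
      + (8 / c + 4) * (dot2 v v / dot2 s s).
Proof.
move=> s0 /andP[tb0 tb1] th /andP[c0 ctb]; rewrite frob_rank1_update//.
have ss := dot2_gt0 _ s0.
have /andP[th1 th2] : - tb <= theta - 1 <= tb by rewrite -ler_norml.
set q := E *m s; pose a := theta * (1 - theta).
have := dot2_ge0 (c *: q - (2 * a) *: v).
have := dot2_ge0 q; have := dot2_ge0 v.
rewrite !dot2_lin (dot2C v q).
set P := dot2 q q; set Q := dot2 v v; set W := dot2 q v => Q0 P0 cs.
have a2 : a ^+ 2 <= 4.
  have : 0 <= theta <= 2 by lra.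
  have : -1 <= 1 - theta <= 1 by lra.
  move=> /andP[h1 h2] /andP[h3 h4].
  have : a <= 2 by rewrite /a; nra.
  have : -2 <= a by rewrite /a; nra.
  nra.
(* Young's inequality, from the nonnegativity of |c q - 2 a v|^2 *)
have aW : 2 * a * W <= c / 2 * P + 8 / c * Q.
  apply: (@le_trans _ _ (c / 2 * P + 2 * a ^+ 2 / c * Q)); last first.
    rewrite lerD2l ler_wpM2r// ler_wpM2r ?invr_ge0 ?(ltW c0)//; lra.
  rewrite -(ler_pM2l c0).
  have -> : c * (c / 2 * P + 2 * a ^+ 2 / c * Q) = c ^+ 2 / 2 * P + 2 * a ^+ 2 * Q.
    by field; rewrite gt_eqF.
  nra.
have cP : c * P <= (2 * theta - theta ^+ 2) * P.
  rewrite ler_wpM2r//; nra.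
have tQ : theta ^+ 2 * Q <= 4 * Q by rewrite ler_wpM2r//; nra.
have -> : frob E - c / 2 * (P / dot2 s s) + (8 / c + 4) * (Q / dot2 s s)
    = frob E + (- (c / 2 * P) + (8 / c + 4) * Q) / dot2 s s by ring.
rewrite lerD2l.
rewrite ler_wpM2r ?invr_ge0 ?(ltW ss)//.
rewrite /a in aW *; lra.
Qed.

(** Sherman-Morrison. *)
Lemma rank1_unitmx u s : 1 + dot2 s u != 0 -> 1%:M + u *m s^T \in unitmx.
Proof.
move=> t0; set t := dot2 s u in t0.
suff H : (1%:M + u *m s^T) *m (1%:M - (1 + t)^-1 *: (u *m s^T)) = 1%:M.
  by have [] := mulmx1_unit H.
rewrite mulmxBr mulmx1 -scalemxAr mulmxDl mul1mx.
have -> : u *m s^T *m (u *m s^T) = t *: (u *m s^T).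
  rewrite mulmxA -(mulmxA u) (mx11_scalar (s^T *m u)) mul_mx_scalar.
  by rewrite -scalemxAl.
have -> : u *m s^T + t *: (u *m s^T) = (1 + t) *: (u *m s^T).
  by rewrite scalerDl scale1r.
by rewrite scalerA mulVf// scale1r addrK.
Qed.

End Euclidean.

Section BroydenScheme.
Context {R : realType} {n : nat}.
Local Notation V := 'cV[R]_n.
Variables (T : V -> V) (p : supermann_params R) (s : supermann_run R n)
  (tb : R) (B : nat -> 'M[R]_n).
Hypotheses (htb : 0 < tb < 1) (hB : modified_broyden T p s tb B).
Local Notation theta k := (vartheta T p s tb B k).
Local Notation gamma k := (gamma_ T p s B k).

(** This is what the damping is designed for: theta stays away from 0 and 2, and
    the update multiplies the determinant by a nonzero factor. *)
Lemma vartheta_spec k :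
  `|theta k - 1| <= tb /\ 1 + theta k * (gamma k - 1) != 0.
Proof.
have /andP[tb0 tb1] := htb; rewrite /vartheta; set g := gamma_ _ _ _ _ _.
case: ifPn => [tg|].
  rewrite subrr normr0 mul1r subrKC; split; first exact: ltW.
  by rewrite -normr_gt0; apply: lt_le_trans tg.
rewrite -ltNge ltr_norml => /andP[g1 g2].
have g'0 : 0 < 1 - g by lra.
have [g0|g0] := ltP g 0; rewrite ?expr1 ?expr0 ?mulN1r ?mul1r ?opprK.
  split.
    have -> : (1 + tb) / (1 - g) - 1 = (tb + g) / (1 - g) by field; rewrite gt_eqF.
    by rewrite ler_norml ler_pdivlMr// ler_pdivrMr//; apply/andP; split; nra.
  have -> : 1 + (1 + tb) / (1 - g) * (g - 1) = - tb by field; rewrite gt_eqF.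
  by rewrite oppr_eq0 gt_eqF.
split.
  have -> : (1 - tb) / (1 - g) - 1 = (g - tb) / (1 - g) by field; rewrite gt_eqF.
  by rewrite ler_norml ler_pdivlMr// ler_pdivrMr//; apply/andP; split; nra.
have -> : 1 + (1 - tb) / (1 - g) * (g - 1) = tb by field; rewrite gt_eqF.
by rewrite gt_eqF.
Qed.

Lemma broyden_update k : B k.+1 = B k + (dot2 (s_ p s k) (s_ p s k))^-1 *:
  ((theta k *: (y_ T p s k - B k *m s_ p s k)) *m (s_ p s k)^T).
Proof.
have [_ _ ->] := hB; congr (_ + _ *: (_ *m _)).
rewrite /ytilde; move: (B k *m _) (y_ _ _ _ _) (theta k) => u v a.
by apply/matrixP => i j; rewrite !mxE; ring.
Qed.

(** The update is B k (1 + u s^T) with 1 + <s, u> = 1 + theta (gamma - 1). *)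
Lemma broyden_unit k : B k \in unitmx.
Proof.
elim: k => [|k IH]; first by case: hB.
rewrite broyden_update; set sk := s_ p s k; set yk := y_ T p s k.
have [_ t0] := vartheta_spec k.
pose u := (dot2 sk sk)^-1 *: (theta k *: (invmx (B k) *m yk - sk)).
have [sk0|skN0] := eqVneq sk 0; first by rewrite sk0 trmx0 mulmx0 scaler0 addr0.
have uE : B k *m u = (dot2 sk sk)^-1 *: (theta k *: (yk - B k *m sk)).
  by rewrite /u -!scalemxAr mulmxBr mulKVmx.
have -> : B k + (dot2 sk sk)^-1 *: ((theta k *: (yk - B k *m sk)) *m sk^T)
        = B k *m (1%:M + u *m sk^T).
  by rewrite mulmxDr mulmx1 mulmxA uE -[in RHS]scalemxAl.
rewrite unitmx_mul IH; apply: rank1_unitmx.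
have ss := dot2_gt0 _ skN0.
suff -> : dot2 sk u = theta k * (gamma k - 1) by [].
rewrite /u /gamma_ -/sk -/yk; move: (invmx (B k) *m yk) (theta k) => h a.
clear -ss; clearbody sk; rewrite !dot2_lin (dot2C sk h).
by field; rewrite gt_eqF.
Qed.

End BroydenScheme.

(** * From summable errors to the Dennis-More limit *)

Lemma cvg0_eventually {R : realType} (f : nat -> R) :
  (forall k, 0 <= f k) ->
  (forall d : R, 0 < d -> exists N, forall k, (N <= k)%N -> f k <= d) ->
  f @ \oo --> (0 : R).
Proof.
move=> f0 H; apply/cvgrPdist_le => d /H[N NP].
by exists N => // k /NP /=; rewrite sub0r normrN ger0_norm.
Qed.

Lemma ratio_cvg0 {R : realType} (f g : nat -> R) :
  (forall k, 0 <= f k) -> (forall k, 0 < g k) ->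
  (forall d : R, 0 < d -> exists N, forall k, (N <= k)%N -> f k <= d * g k) ->
  (fun k => f k / g k) @ \oo --> (0 : R).
Proof.
move=> f0 g0 H; apply: cvg0_eventually => [k|d /H[N NP]].
  by rewrite divr_ge0// ltW.
by exists N => k /NP; rewrite ler_pdivrMr.
Qed.

(** a k + K / (1 - w) * w^k is nonincreasing and nonnegative, hence convergent,
    and its decrements bound d * u k. *)
Lemma summable_decrease {R : realType} (a u : nat -> R) (d K w : R) N :
  0 < d -> 0 <= K -> 0 < w < 1 -> (forall k, 0 <= a k) ->
  (forall k, (N <= k)%N -> 0 <= u k) ->
  (forall k, (N <= k)%N -> a k.+1 <= a k - d * u k + K * w ^+ k) ->
  forall r : R, 0 < r -> exists m, forall k, (m <= k)%N -> u k <= r.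
Proof.
move=> d0 K0 /andP[w0 w1] a0 u0 step r r0.
pose b k := a (N + k)%N + K / (1 - w) * w ^+ (N + k).
have b_step k : b k.+1 <= b k - d * u (N + k)%N.
  have := step _ (leq_addr k N); rewrite /b addnS exprS.
  have -> : K * w ^+ (N + k) = K / (1 - w) * w ^+ (N + k)
      - K / (1 - w) * (w * w ^+ (N + k)) by field; rewrite subr_eq0 gt_eqF.
  lra.
have b0 k : 0 <= b k.
  by rewrite addr_ge0 ?mulr_ge0 ?exprn_ge0 ?invr_ge0 ?subr_ge0 ?(ltW w0) ?(ltW w1).
have b_cvg : cvgn b.
  apply: nonincreasing_is_cvgn; last by exists 0 => _ [k _ <-].
  apply/nonincreasing_seqP => k; apply: le_trans (b_step k) _.
  by rewrite gerBl mulr_ge0 ?(ltW d0)// u0// leq_addr.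
have dr0 : 0 < d * r / 2 by rewrite divr_gt0// mulr_gt0.
have [m _ mP] := (@cvgrPdist_le _ _ _ _ _ _ _).1 b_cvg _ dr0.
exists (N + m)%N => k Nmk.
have Nk : (N <= k)%N by apply: leq_trans Nmk; rewrite leq_addr.
have mk : (m <= k - N)%N by rewrite leq_subRL.
have := mP _ mk; have := mP _ (leqW mk); have := b_step (k - N)%N.
rewrite /= subnKC// !ler_norml => h1 /andP[h2 h3] /andP[h4 h5].
by rewrite -(ler_pM2l d0); lra.
Qed.

Section DennisMore.
Context {R : realType} {n : nat}.
Local Notation V := 'cV[R]_n.
Variables (T : V -> V) (p : supermann_params R) (s : supermann_run R n)
  (tb : R) (B : nat -> 'M[R]_n).
Hypotheses (htb : 0 < tb < 1) (hB : modified_broyden T p s tb B).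
Hypotheses (beta0 : 0 < beta p) (dir0 : forall k, dir s k != 0).

Lemma s_E k : s_ p s k = tau p s k *: dir s k.
Proof. by rewrite /s_ /w_ /candidate addrC addKr. Qed.

Lemma tau_gt0 k : 0 < tau p s k.
Proof. exact: exprn_gt0. Qed.

Lemma s_neq0 k : s_ p s k != 0.
Proof. by rewrite s_E scaler_eq0 negb_or gt_eqF ?tau_gt0//=. Qed.

(** The squared Frobenius norm of B k - J is nonnegative and decreases by the
    quantities that are to vanish, up to a geometric error. *)
Lemma broyden_dennis_more (J : 'M[R]_n) (C w : R) N :
  0 <= C -> 0 < w < 1 ->
  (forall k, (N <= k)%N ->
     `|y_ T p s k - J *m s_ p s k| <= C * w ^+ k * `|s_ p s k|) ->
  forall r : R, 0 < r -> exists m, forall k, (m <= k)%N ->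
    `|(B k - J) *m dir s k| <= r * `|dir s k|.
Proof.
move=> C0 w01 yJ r r0; have /andP[tb0 tb1] := htb; have /andP[w0 w1] := w01.
pose c := 1 - tb ^+ 2.
have c0 : 0 < c by rewrite /c; nra.
pose E k := B k - J.
pose u k := dot2 (E k *m s_ p s k) (E k *m s_ p s k) / dot2 (s_ p s k) (s_ p s k).
have ss k : 0 < dot2 (s_ p s k) (s_ p s k) := dot2_gt0 _ (s_neq0 k).
have u0 k : 0 <= u k by rewrite divr_ge0 ?dot2_ge0// ltW.
pose K := (8 / c + 4) * (n%:R * C ^+ 2).
have c8 : 0 <= 8 / c + 4 by rewrite addr_ge0// divr_ge0// ltW.
have K0 : 0 <= K by rewrite !mulr_ge0.
have step k : (N <= k)%N ->
    frob (E k.+1) <= frob (E k) - c / 2 * u k + K * w ^+ k.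
  move=> Nk; have [th _] := vartheta_spec T p s tb B htb k.
  have -> : E k.+1 = E k + (dot2 (s_ p s k) (s_ p s k))^-1 *:
      ((vartheta T p s tb B k *: ((y_ T p s k - J *m s_ p s k) - E k *m s_ p s k))
         *m (s_ p s k)^T).
    rewrite /E (broyden_update _ _ _ _ _ hB) addrAC; congr (_ + _ *: (_ *: _ *m _)).
    by rewrite mulmxBl opprB addrA subrK.
  have tbI : 0 <= tb < 1 by rewrite ltW.
  have cI : 0 < c <= 1 - tb ^+ 2 by rewrite c0 lexx.
  apply: le_trans (broyden_error_decrease _ _ _ _ tb c (s_neq0 k) tbI th cI) _.
  rewrite lerD2l /K -mulrA ler_wpM2l// ler_pdivrMr//.
  apply: le_trans (dot2_le_sqr_norm _) _; rewrite -!mulrA ler_wpM2l//.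
  apply: (@le_trans _ _ ((C * w ^+ k * `|s_ p s k|) ^+ 2)).
    by rewrite ler_sqr ?nnegrE ?mulr_ge0 ?exprn_ge0 ?(ltW w0)// yJ.
  rewrite [leRHS]mulrA -expr2 !exprMn -mulrA ler_wpM2l ?sqr_ge0//.
  apply: ler_pM; rewrite ?sqr_ge0 ?sqr_norm_le_dot2//.
  by rewrite expr2 ler_piMl ?exprn_ge0 ?exprn_ile1 ?(ltW w0) ?(ltW w1).
have n0 : 0 < n%:R + 1 :> R by rewrite ltr_wpDl.
have r'0 : 0 < r ^+ 2 / (n%:R + 1) by rewrite divr_gt0// exprn_gt0.
have c2 : 0 < c / 2 by rewrite divr_gt0.
have [m mP] := summable_decrease _ u (c / 2) K w N c2 K0 w01
  (fun k => frob_ge0 (E k)) (fun k _ => u0 k) step _ r'0.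
exists m => k /mP uk.
have : `|E k *m s_ p s k| <= r * `|s_ p s k|.
  rewrite -ler_sqr ?nnegrE ?mulr_ge0 ?(ltW r0)//.
  apply: le_trans (sqr_norm_le_dot2 _) _.
  have -> : dot2 (E k *m s_ p s k) (E k *m s_ p s k)
      = u k * dot2 (s_ p s k) (s_ p s k) by rewrite divfK// gt_eqF.
  apply: (@le_trans _ _ (r ^+ 2 / (n%:R + 1) * ((n%:R + 1) * `|s_ p s k| ^+ 2))).
    apply: ler_pM => //; first exact: ltW.
    apply: le_trans (dot2_le_sqr_norm _) _.
    by rewrite ler_wpM2r ?sqr_ge0// lerDl.
  by rewrite mulrA divfK ?gt_eqF// exprMn.
rewrite s_E -scalemxAr !normrZ gtr0_norm ?tau_gt0// mulrCA.
by rewrite ler_pM2l ?tau_gt0.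
Qed.

End DennisMore.

(** * Acceptance of full steps *)

Section Endgame.
Context {R : realType} {n : nat} (ip : {dot 'cV[R]_n for idfun}).
Local Notation V := 'cV[R]_n.
Local Notation nrm := (hnorm ip).
Variables (T : V -> V) (alpha : R).
Variables (p : supermann_params R) (s : supermann_run R n).
Hypotheses (hp : valid_params alpha p) (hs : supermann_scheme ip T alpha p s)
  (hns : never_solved T p s).
Local Notation F := (residual T).
Local Notation x_ := (iter_x s).
Local Notation r k := (nrm (F (x_ k))).
Hypothesis superlinear_dir : forall d : R, 0 < d -> exists N, forall k,
  (N <= k)%N -> nrm (F (x_ k + dir s k)) <= d * r k.
Hypothesis r_small : forall d : R, 0 < d -> exists N, forall k,
  (N <= k)%N -> r k <= d.

Definition full_step k : Prop := [/\ backtracks s k = 0%N, ~ K2 ip T alpha p s k &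
  x_ k.+1 = x_ k + dir s k].

Lemma candidate0 k : candidate p s k 0 = x_ k + dir s k.
Proof. by rewrite /candidate expr0 scale1r. Qed.

Lemma blind_full_step k : K0 ip T p s k -> full_step k /\ eta s k.+1 = r k.
Proof.
move=> bl; have [_ _ step] := hs.
have [[_ [b0 etaE _ xE]]|[/andP[/negP]]//|[/and3P[/negP]]//] := step k.
split=> //; split=> //; first by move=> /and3P[/negP].
by rewrite xE /w_ b0 candidate0.
Qed.

(** The step size 1 is tried first, so it is accepted.  The new rsafe is at least
    the new residual, which lets the next iteration pass the same half of the test. *)
Lemma educated_full_step k : ~~ blind_test ip T p s k ->
  educated_test ip T p s k 0 -> full_step k /\ rsafe s k.+1 >= r k.+1.
Proof.
move=> nbl ed; have [_ _ step] := hs.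
have b0 (b := backtracks s k) : (forall j, (j < b)%N -> rejected ip T alpha p s k j) ->
    b = 0%N.
  by case: b => // b /(_ 0%N isT) [/negP].
have [[bl _]|[k1 /b0 bk [_ rsE xE]]|[k2 /b0 bk _]] := step k.
- by move: nbl; rewrite (bl : is_true _).
- rewrite rsE xE; split; last first.
    have [_ _ /andP[q0 _] _] := hp.
    by rewrite lerDl exprn_ge0.
  split=> //; last by rewrite xE /w_ bk candidate0.
  by case/and3P; rewrite bk ed.
- by case/and3P: k2; rewrite bk ed.
Qed.

(** If blind iterations stopped, eta would be a positive constant that the
    residuals eventually fall below.  After a late blind iteration, eta is the
    last residual, and the superlinear decrease makes the next iteration blind. *)
Lemma eventually_blind : 0 < c0 p -> exists N, forall k, (N <= k)%N -> K0 ip T p s k.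
Proof.
move=> c0p; have [_ _ step] := hs; have [N NP] := superlinear_dir _ c0p.
have [k Nk kb] : exists2 k, (N <= k)%N & K0 ip T p s k.
  apply: contrapT => nb.
  have nb' k : (N <= k)%N -> ~ K0 ip T p s k by move=> Nk kb; apply: nb; exists k.
  have etaE i : eta s (N + i) = eta s N.
    elim: i => [|i IH]; first by rewrite addn0.
    rewrite addnS -IH; have := nb' _ (leq_addr i N).
    by have [[]//|[_ _ []]//|[_ _ []]//] := step (N + i)%N.
  have e0 : 0 < c0 p * eta s N.
    by rewrite mulr_gt0//; apply: (eta_gt0 ip T alpha p s hs hns).
  have [m mP] := r_small _ e0.
  apply: (nb' (N + m)%N); first exact: leq_addr.
  by rewrite /K0 /= /blind_test etaE; apply: mP; exact: leq_addl.
exists k => j kj; rewrite -(subnKC kj); elim: (j - k)%N => [|i IH].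
  by rewrite addn0.
have Nki : (N <= k + i)%N := leq_trans Nk (leq_addr i k).
have [[_ _ xE] etaE] := blind_full_step _ IH.
by rewrite addnS /K0 /= /blind_test etaE xE; exact: NP.
Qed.

(** The same argument with rsafe in place of eta; with c0 = 0 no iteration is
    blind. *)
Lemma eventually_educated : c0 p = 0 -> 0 < c1 p ->
  exists N, forall k, (N <= k)%N -> full_step k.
Proof.
move=> c0p c1p; have [_ _ step] := hs; have [N NP] := superlinear_dir _ c1p.
have nbl k : ~~ blind_test ip T p s k.
  by rewrite /blind_test c0p mul0r -ltNge (residual_gt0 ip T p s hns).
have ed k : (N <= k)%N -> r k <= rsafe s k -> educated_test ip T p s k 0.
  by move=> Nk rk; rewrite /educated_test rk candidate0 NP.
have [k Nk kb] : exists2 k, (N <= k)%N & r k <= rsafe s k.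
  apply: contrapT => nb.
  have nb' k : (N <= k)%N -> ~ r k <= rsafe s k by move=> Nk kb; apply: nb; exists k.
  have rsE i : rsafe s (N + i) = rsafe s N.
    elim: i => [|i IH]; first by rewrite addn0.
    rewrite addnS -IH; have := nb' _ (leq_addr i N).
    have [[_ [_ _ -> _]]//|[/andP[_ /andP[rk _]] _ _]|[_ _ []]//] := step (N + i)%N.
    by move/(_ rk).
  have [m mP] := r_small _ (rsafe_gt0 ip T alpha p s hp hs hns N).
  apply: (nb' (N + m)%N); first exact: leq_addr.
  by rewrite rsE; apply: mP; exact: leq_addl.
exists k => j kj.
suff : r j <= rsafe s j.
  by move=> /(ed _ (leq_trans Nk kj)) /(educated_full_step _ (nbl j))[].
rewrite -(subnKC kj); elim: (j - k)%N => [|i IH]; first by rewrite addn0.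
have Nki : (N <= k + i)%N := leq_trans Nk (leq_addr i k).
by rewrite addnS; case: (educated_full_step _ (nbl _) (ed _ Nki IH)).
Qed.

Lemma eventually_full_step : 0 < c0 p \/ 0 < c1 p ->
  exists N, forall k, (N <= k)%N -> full_step k.
Proof.
move=> c01; have [/andP[c00 _] _ _ _] := hp.
have [c0p|c0N] := eqVneq (c0 p) 0.
  case: c01 => [|c1p]; first by rewrite c0p ltxx.
  exact: eventually_educated.
have [|N NP] := eventually_blind; first by rewrite lt_def c0N.
by exists N => k /NP /blind_full_step[].
Qed.

Lemma full_step_Q_superlinear N : (forall k, (N <= k)%N -> full_step k) ->
  Q_superlinear ip (fun k => F (x_ k)).
Proof.
move=> full; apply: ratio_cvg0 => [k|k|d /superlinear_dir[m mP]].
- exact: hnorm_ge0.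
- exact: (residual_gt0 ip T p s hns).
exists (maxn N m) => k; rewrite geq_max => /andP[/full[_ _ ->] mk].
exact: mP.
Qed.

(** With residuals at least halving, the remaining path length after x k is at
    most 2 M r_k.  Before N', Delta only has to dominate the distance. *)
Lemma full_step_R_superlinear (xs : V) (M : R) N : 0 < M ->
  x_ @ \oo --> xs -> (forall k, nrm (dir s k) <= M * r k) ->
  (forall k, (N <= k)%N -> full_step k) -> R_superlinear ip x_ xs.
Proof.
move=> M0 xcv dirM full.
have half : 0 < 2^-1 :> R by rewrite invr_gt0.
have [m mP] := superlinear_dir _ half.
pose N' := maxn N m.
pose b k := 2 * M * r k.
have b0 k : 0 < b k by rewrite !mulr_gt0// (residual_gt0 ip T p s hns).
have xb k : (N' <= k)%N -> nrm (x_ k.+1 - x_ k) <= b k - b k.+1.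
  rewrite geq_max => /andP[/full[_ _ xE] /mP]; rewrite -xE => rr.
  have -> : x_ k.+1 - x_ k = dir s k by rewrite xE addrC addKr.
  apply: le_trans (dirM k) _; rewrite /b.
  have : M * r k.+1 <= M * (2^-1 * r k) by rewrite ler_wpM2l// ltW.
  lra.
have xs_b := dist_to_limit ip x_ xs b N' xcv (fun k _ => ltW (b0 k)) xb.
exists (fun k => if (k < N')%N then nrm (x_ k - xs) + 1 else b k); split.
- by move=> k; case: ifP => // _; rewrite ltr_wpDl// hnorm_ge0.
- apply: cvg0_eventually => [k|d d0].
    by case: ifP => _; rewrite ?addr_ge0 ?hnorm_ge0// ltW.
  have [|l lP] := r_small (d / (2 * M)); first by rewrite divr_gt0// mulr_gt0.
  exists (maxn N' l) => k; rewrite geq_max => /andP[Nk /lP rk].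
  by rewrite ltnNge Nk /= /b mulrC -ler_pdivlMr// mulr_gt0.
- apply: ratio_cvg0 => [k|k|d /superlinear_dir[l lP]].
  + by case: ifP => _; rewrite ?addr_ge0 ?hnorm_ge0// ltW.
  + by case: ifP => // _; rewrite ltr_wpDl// hnorm_ge0.
  exists (maxn N' l) => k; rewrite geq_max => /andP[Nk /lP rk].
  rewrite !ltnNge Nk (leqW Nk) /= /b mulrCA ler_wpM2l ?mulr_ge0 ?(ltW M0)//.
  by move: Nk; rewrite geq_max => /andP[/full[_ _ ->] _].
- move=> k; case: ltnP => [_|/xs_b//].
  by rewrite lerDl.
Qed.

End Endgame.

(** * The Dennis-More condition for the scheme *)

Section MainEstimates.
Context {R : realType} {n : nat} (ip : {dot 'cV[R]_n for idfun}).
Local Notation V := 'cV[R]_n.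
Local Notation nrm := (hnorm ip).
Variables (T : V -> V) (alpha : R).
Hypotheses (halpha : 0 < alpha <= 1) (hT : averaged ip alpha T)
  (hfix : fix_set T !=set0).
Variables (p : supermann_params R) (s : supermann_run R n).
Hypotheses (hp : valid_params alpha p) (hs : supermann_scheme ip T alpha p s)
  (hns : never_solved T p s).
Variables (tb : R) (B : nat -> 'M[R]_n) (xs : V).
Hypotheses (htb : 0 < tb < 1) (hB : modified_broyden T p s tb B)
  (hH : bounded_fun (fun k => invmx (B k))) (hx : iter_x s @ \oo --> xs)
  (hsub : metrically_subregular ip (residual T) xs).
Local Notation F := (residual T).
Local Notation x_ := (iter_x s).
Local Notation r k := (nrm (F (x_ k))).
Local Notation e k := (dist ip (x_ k) (zer F)).

Lemma iterates_near (d : R) : 0 < d ->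
  exists N, forall k, (N <= k)%N -> nrm (x_ k - xs) < d.
Proof.
move=> d0; have [a a0 aN] := hnorm_le_norm ip.
have da0 : 0 < d / a by rewrite divr_gt0.
have [N _ NP] := (@cvgrPdist_lt _ _ _ _ _ _ _).1 hx _ da0.
exists N => k /NP /=; rewrite distrC => xk.
by apply: le_lt_trans (aN _) _; rewrite mulrC -ltr_pdivlMr.
Qed.

Lemma residual_small (d : R) : 0 < d ->
  exists N, forall k, (N <= k)%N -> r k <= d.
Proof.
move=> d0; have [|N NP] := iterates_near (d / 2); first by rewrite divr_gt0.
exists N => k /NP xk; have := residual_lipschitz ip T alpha halpha hT (x_ k) xs.
by have [-> _] := hsub; rewrite subr0; lra.
Qed.

Lemma dir_bounded : exists2 M : R, 0 < M & forall k, nrm (dir s k) <= M * r k.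
Proof.
have [M' M'0 HM] := (ex_strict_bound_gt0 hH).
have [a a0 aN] := hnorm_le_norm ip; have [b b0 bN] := norm_le_hnorm ip.
exists (a * (n%:R + 1) * M' * b) => [|k].
  by rewrite !mulr_gt0// ltr_wpDl.
have [_ -> _] := hB; rewrite hnorm_opp.
apply: le_trans (aN _) _; rewrite -!mulrA ler_wpM2l ?(ltW a0)//.
apply: le_trans (norm_mulmx_le _ _ _ _ _) _; rewrite -mulrA.
apply: ler_pM => //; rewrite ?mulr_ge0 ?lerDl//.
by apply: ler_pM => //; exact: ltW (HM k I).
Qed.

Lemma dir_neq0 k : dir s k != 0.
Proof.
have [_ dE _] := hB; apply/eqP => d0.
have Bu := broyden_unit T p s tb B htb hB k.
have : B k *m dir s k = - F (x_ k) by rewrite dE mulmxN mulKVmx.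
by rewrite d0 mulmx0 => /esym/eqP; rewrite oppr_eq0; case: hns => /(_ k) /eqP /negbTE ->.
Qed.

(** The steps are bounded by multiples of the distances to the zeros, which
    decay geometrically, so the remaining path length does too. *)
Lemma iterates_linear_rate : exists (C w : R) N, [/\ 0 < C, 0 < w < 1 &
  forall k, (N <= k)%N -> nrm (x_ k - xs) <= C * w ^+ k /\
    nrm (dir s k) <= C * w ^+ k].
Proof.
have [M M0 dirM] := dir_bounded.
have [Fxs [eps [gam [eps0 gam0 sub]]]] := hsub.
have [N NP] := iterates_near eps eps0.
have subreg k : (N <= k)%N -> e k <= gam * r k by move=> /NP /sub.
have [C [w [C0 w01 rate]]] := supermann_linear_rate ip T alpha halpha hT hfix p s
  hp hs hns M gam N (ltW M0) dirM gam0 subreg.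
have /andP[w0 w1] := w01; have w1' : 0 < 1 - w by rewrite subr_gt0.
pose b k := (2 * M + 2) * C / (1 - w) * w ^+ k.
have K0 : 0 < (2 * M + 2) * C / (1 - w).
  by rewrite divr_gt0// mulr_gt0// addr_gt0// mulr_gt0.
have xb k : (N <= k)%N -> nrm (x_ k - xs) <= b k.
  apply: (dist_to_limit ip x_ xs b N hx) => {}k Nk.
    by rewrite mulr_ge0 ?exprn_ge0 ?(ltW K0) ?(ltW w0).
  have -> : b k - b k.+1 = (2 * M + 2) * (C * w ^+ k).
    by rewrite /b exprS; field; rewrite subr_eq0 gt_eqF.
  apply: le_trans (step_le_dist ip T alpha halpha hT hfix p s hp hs hns M
    (ltW M0) dirM k) _.
  by rewrite ler_wpM2l ?rate// addr_ge0// mulr_ge0// ltW.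
exists ((2 * M + 2) * C / (1 - w) + M * (2 * C)), w, N; split=> //.
  by rewrite addr_gt0// !mulr_gt0.
move=> k Nk; have wk : 0 <= w ^+ k by rewrite exprn_ge0// ltW.
rewrite mulrDl; split.
  by rewrite (le_trans (xb k Nk))// lerDl !mulr_ge0 ?(ltW M0) ?(ltW C0).
apply: le_trans (dirM k) _.
have : M * r k <= M * (2 * (C * w ^+ k)).
  rewrite ler_wpM2l ?(ltW M0)//; have := rate k Nk.
  have := residual_le_2dist ip T alpha halpha hT hfix s k; lra.
have := mulr_ge0 (ltW K0) wk; lra.
Qed.

Variables (A : 'M[R]_n) (C0 d0 : R).
Hypotheses (C0_ge0 : 0 <= C0) (d0_gt0 : 0 < d0).
Hypothesis strict : forall (rho : R) x y, rho < d0 -> `|x - xs| <= rho ->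
  `|y - xs| <= rho -> `|F x - F y - A *m (x - y)| <= C0 * rho * `|x - y|.

(** The strict estimate between x k and a point of the segment to x k + dir s k;
    the factor t covers both the candidate w_k and the full step. *)
Lemma linearization_error : exists (C w : R) N, [/\ 0 <= C, 0 < w < 1 &
  forall k (t : R), (N <= k)%N -> 0 <= t <= 1 ->
    `|F (x_ k + t *: dir s k) - F (x_ k) - A *m (t *: dir s k)|
      <= C * w ^+ k * `|t *: dir s k|].
Proof.
have [C [w [N [C_gt0 w01 rate]]]] := iterates_linear_rate.
have /andP[w0 w1] := w01.
have [b b0 bN] := norm_le_hnorm ip.
pose rho k := 2 * b * C * w ^+ k.
have bC : 0 < 2 * b * C by rewrite !mulr_gt0.
have [||m mP] := geometric_small w (d0 / (2 * b * C) / 2).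
- by rewrite (ltW w0).
- by rewrite !divr_gt0.
exists (C0 * (2 * b * C)), w, (maxn N m); split=> //.
  by rewrite mulr_ge0// ltW.
move=> k t; rewrite geq_max => /andP[/rate[xk dk] /mP wk] /andP[t0 t1].
have rho_lt : 2 * b * C * w ^+ k < d0.
  rewrite mulrC -ltr_pdivlMr//; apply: le_lt_trans wk _.
  by rewrite ltr_pdivrMr// ltr_pMr ?divr_gt0// ltr1n.
have {}xk : `|x_ k - xs| <= b * C * w ^+ k.
  by apply: le_trans (bN _) _; rewrite -mulrA ler_wpM2l// ltW.
have {}dk : `|t *: dir s k| <= b * C * w ^+ k.
  rewrite normrZ ger0_norm//; apply: (@le_trans _ _ `|dir s k|).
    by rewrite ler_piMl.
  by apply: le_trans (bN _) _; rewrite -mulrA ler_wpM2l// ltW.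
have wk0 : 0 <= b * C * w ^+ k by rewrite !mulr_ge0 ?exprn_ge0 ?ltW.
have := strict _ (x_ k + t *: dir s k) (x_ k) rho_lt.
rewrite [_ + _ - x_ k]addrC addKr mulrA; apply.
  rewrite addrAC; apply: le_trans (ler_normD _ _) _.
  by have := lerD xk dk; lra.
lra.
Qed.

(** The Dennis-More condition, as B k *m dir s k is the opposite of the
    residual. *)
Lemma broyden_dir_error : forall d : R, 0 < d -> exists N, forall k, (N <= k)%N ->
  `|F (x_ k) + A *m dir s k| <= d * `|dir s k|.
Proof.
have [C [w [N [C_ge0 w01 lin]]]] := linearization_error.
have [_ _ _ [/andP[beta0 beta1] _ _]] := hp.
move=> d dpos.
have [|m mP] := broyden_dennis_more T p s tb B htb hB beta0 dir_neq0 A C w N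
  C_ge0 w01 _ d dpos.
  move=> k Nk; rewrite /y_ s_E /w_ /candidate -/(tau p s k).
  by apply: lin => //; exact: beta_pow_le1 hp _.
exists m => k /mP; rewrite mulmxBl.
have [_ dE _] := hB.
have Bu := broyden_unit T p s tb B htb hB k.
have -> : B k *m dir s k = - F (x_ k) by rewrite dE mulmxN mulKVmx.
by rewrite -opprD normrN.
Qed.

Lemma full_step_residual : forall d : R, 0 < d -> exists N, forall k, (N <= k)%N ->
  `|F (x_ k + dir s k)| <= d * `|dir s k|.
Proof.
move=> d dpos; have d2 : 0 < d / 2 by rewrite divr_gt0.
have [C [w [N [C_ge0 w01 lin]]]] := linearization_error.
have /andP[w0 w1] := w01; have C1 : 0 < C + 1 by rewrite ltr_wpDl.
have [m mP] := broyden_dir_error _ d2.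
have [||l lP] := geometric_small w (d / 2 / (C + 1)).
- by rewrite (ltW w0).
- by rewrite divr_gt0.
exists (maxn N (maxn m l)) => k; rewrite !geq_max => /and3P[Nk /mP mk /lP lk].
have := lin k 1 Nk; rewrite !scale1r ler01 lexx => /(_ isT) link.
have -> : F (x_ k + dir s k) = F (x_ k + dir s k) - F (x_ k) - A *m dir s k
    + (F (x_ k) + A *m dir s k) by rewrite -[_ - _ - _]addrA -opprD subrK.
apply: le_trans (ler_normD _ _) _.
have -> : d * `|dir s k| = d / 2 * `|dir s k| + d / 2 * `|dir s k|.
  by rewrite -mulrDl -splitr.
apply: lerD => //; apply: le_trans link _; rewrite ler_wpM2r//.
apply: (@le_trans _ _ (C * (d / 2 / (C + 1)))); first by rewrite ler_wpM2l.
by rewrite mulrA ler_pdivrMr// mulrC ler_wpM2l ?(ltW d2)// lerDl.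
Qed.

End MainEstimates.

Theorem mainTheorem8 (R : realType) (n : nat) (ip : {dot 'cV[R]_n for idfun})
    (T : 'cV[R]_n -> 'cV[R]_n) (alpha : R) (p : supermann_params R)
    (s : supermann_run R n) (thetabar : R) (B : nat -> 'M[R]_n)
    (xstar : 'cV[R]_n)
    (halpha : 0 < alpha <= 1)
    (hT : averaged ip alpha T)
    (hfix : fix_set T !=set0)
    (hp : valid_params alpha p)
    (hs : supermann_scheme ip T alpha p s)
    (hns : never_solved T p s)
    (hthetabar : 0 < thetabar < 1)
    (hB : modified_broyden T p s thetabar B)
    (hH : bounded_fun (fun k => invmx (B k)))
    (hx : iter_x s @ \oo --> xstar)
    (hcalm : calmly_semidifferentiable ip (residual T) xstar)
    (hsub : metrically_subregular ip (residual T) xstar) :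
  [/\ differentiable (residual T) xstar,
      (fun k => hnorm ip (residual T (iter_x s k)
                          + jacobian_mx (residual T) xstar *m dir s k)
                / hnorm ip (dir s k)) @ \oo --> (0 : R),
      (fun k => hnorm ip (residual T (iter_x s k + dir s k))
                / hnorm ip (residual T (iter_x s k))) @ \oo --> (0 : R) &
      0 < c0 p \/ 0 < c1 p ->
      [/\ \forall k \near \oo, [/\ tau p s k = 1, ~ K2 ip T alpha p s k &
                                   iter_x s k.+1 = iter_x s k + dir s k],
          Q_superlinear ip (fun k => residual T (iter_x s k)),
          R_superlinear ip (iter_x s) xstar &
          0 < c0 p -> finite_set (~` K0 ip T p s)]].
Proof.

have [a a0 aN] := hnorm_le_norm ip; have [b b0 bN] := norm_le_hnorm ip.
have Flip x y : `|residual T x - residual T y| <= b * (2 * a) * `|x - y|.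
  apply: le_trans (bN _) _; rewrite -!mulrA ler_wpM2l ?(ltW b0)//.
  apply: le_trans (residual_lipschitz ip T alpha halpha hT x y) _.
  by rewrite ler_wpM2l.
have [A [C [d [C0 d0 strict]]]] := calm_strict_estimate ip _ _ _ Flip hcalm.
have [diffF JA] : differentiable (residual T) xstar /\
    jacobian_mx (residual T) xstar = A.
  apply: (jacobian_of_quadratic_error _ _ A C d C0 d0) => x xd.
  by apply: strict; rewrite ?subrr ?normr0.
have dir0 := dir_neq0 T p s hns thetabar B hthetabar hB.
have nd0 k : 0 < hnorm ip (dir s k) by rewrite hnorm_gt0 dir0.
have r0 := residual_gt0 ip T p s hns.
have [M M0 dirM] := dir_bounded ip T p s thetabar B hB hH.
have direrr := broyden_dir_error ip T alpha halpha hT hfix p s hp hs hns thetabar B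
  xstar hthetabar hB hH hx hsub A C d C0 d0 strict.
have full := full_step_residual ip T alpha halpha hT hfix p s hp hs hns thetabar B
  xstar hthetabar hB hH hx hsub A C d C0 d0 strict.
have ab0 : 0 < a * b by rewrite mulr_gt0.
have toH (f g : nat -> 'cV[R]_n) : (forall c : R, 0 < c -> exists N, forall k,
      (N <= k)%N -> `|f k| <= c * `|g k|) ->
    forall c : R, 0 < c -> exists N, forall k, (N <= k)%N ->
      hnorm ip (f k) <= c * hnorm ip (g k).
  move=> H c c0; have [|N NP] := H (c / (a * b)); first by rewrite divr_gt0.
  exists N => k /NP fg; apply: le_trans (aN _) _.
  apply: (@le_trans _ _ (a * (c / (a * b) * (b * hnorm ip (g k))))).
    rewrite ler_wpM2l ?(ltW a0)//; apply: le_trans fg _.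
    by rewrite ler_wpM2l// divr_ge0 ?ltW.
  have -> : a * (c / (a * b) * (b * hnorm ip (g k))) = c * hnorm ip (g k).
    by field; rewrite !gt_eqF.
  by [].
have superl (c : R) : 0 < c -> exists N, forall k, (N <= k)%N ->
    hnorm ip (residual T (iter_x s k + dir s k))
      <= c * hnorm ip (residual T (iter_x s k)).
  move=> c0; have [|N NP] := toH _ _ full (c / M); first by rewrite divr_gt0.
  exists N => k /NP H; apply: le_trans H _.
  have -> : c * hnorm ip (residual T (iter_x s k)) =
      c / M * (M * hnorm ip (residual T (iter_x s k))).
    by rewrite mulrA divfK// gt_eqF.
  by rewrite ler_wpM2l// divr_ge0 ?ltW.
have rsmall := residual_small ip T alpha halpha hT s xstar hx hsub.
split=> //.
- rewrite JA; apply: ratio_cvg0 => [k|//|]; first exact: hnorm_ge0.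
  exact: toH.
- by apply: ratio_cvg0 => [k|//|//]; exact: hnorm_ge0.
move=> c01.
have [N NP] := eventually_full_step ip T alpha p s hp hs hns superl rsmall c01.
split.
- exists N => // k /= /NP[b0k k2 xE]; split=> //.
  by rewrite /tau b0k expr0.
- exact: (full_step_Q_superlinear ip T alpha p s hns superl N NP).
- exact: (full_step_R_superlinear ip T alpha p s hns superl rsmall xstar M N M0 hx dirM NP).
move=> c0p.
have [m mP] := eventually_blind ip T alpha p s hs hns superl rsmall c0p.
apply: (@sub_finite_set _ _ `I_m); last exact: finite_II.
move=> k /= kb; rewrite ltnNge; apply/negP => /mP; exact: kb.
Qed.
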